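(* Let $R$ be a commutative, non-noetherian absolutely flat ring which is not semi-artinian. Then $\mathsf{D}(R)$ admits a cohomological Bousfield class which is not a Bousfield class.
   Context: All rings are commutative and unital. A ring $R$ is absolutely flat (von Neumann regular) if for every $r\in R$ there is $x\in R$ with $r=r^2x$. A ring $R$ is semi-artinian if every non-zero homomorphic image of $R$, in the category of $R$-modules, contains a simple submodule. $\mathsf{D}(R)$ is the unbounded derived category of $R$-modules with suspension $\Sigma$ and tensor product $\otimes=\otimes_R$ (all modules over an absolutely flat ring are flat). A localising subcategory is a full triangulated subcategory closed under arbitrary coproducts. A localising subcategory $\mathcal{L}$ of $\mathsf{D}(R)$ is a Bousfield class if there is an $X\in\mathsf{D}(R)$ such that $\mathcal{L} = \{Y\in\mathsf{D}(R)\mid X\otimes Y\cong 0\}$. It is a cohomological Bousfield class if there is an $X\in\mathsf{D}(R)$ such that $\mathcal{L} = \{Y\in\mathsf{D}(R)\mid \operatorname{Hom}(Y,\Sigma^iX)=0 \text{ for all } i\in\mathbb{Z}\}$. *)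

(* Defs.v *)
From HB Require Import structures.
From mathcomp Require Import all_boot all_order all_algebra.
From mathcomp Require Import boolp.

Set Implicit Arguments.
Unset Strict Implicit.
Unset Printing Implicit Defensive.

Import GRing.Theory.
Local Open Scope ring_scope.

(* Submodules and ideals are collective predicates [{pred M}]; since every
  proposition has a boolean reflection in [boolp], these are arbitrary
  subsets. An ideal of [R] is a submodule of the regular module [R^o]. *)

Definition absolutely_flat (R : comPzRingType) : Prop :=
  forall r : R, exists x : R, r = r ^+ 2 * x.

Definition noetherian (R : comPzRingType) : Prop :=
  forall I : {pred R^o}, GRing.submod_closed I ->
  exists (n : nat) (g : 'I_n -> R),
    forall x : R, x \in I <-> exists c : 'I_n -> R, x = \sum_(k < n) c k * g k.

Definition simple_submod (R : comPzRingType) (M : lmodType R) (S : {pred M}) :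
  Prop :=
  [/\ GRing.submod_closed S,
      exists2 x, x \in S & x != 0
    & forall T : {pred M}, GRing.submod_closed T -> {subset T <= S} ->
      (forall x, x \in T -> x = 0) \/ {subset S <= T}].

Definition semi_artinian (R : comPzRingType) : Prop :=
  forall (M : lmodType R) (f : {linear R^o -> M}),
    (forall y : M, exists x : R^o, f x = y) ->
    (exists y : M, y != 0) ->
    exists S : {pred M}, simple_submod S.

(* To avoid transports along equalities of degrees, the differential is given
  for every pair of degrees and vanishes unless they are consecutive. *)

Record complex (R : comPzRingType) := Complex {
  cobj :> int -> lmodType R;
  cd : forall i j : int, {linear cobj i -> cobj j};
  cd_shape : forall (i j : int) (x : cobj i), i + 1 != j -> cd i j x = 0;
  cd_cd : forall (i j k : int) (x : cobj i), cd j k (cd i j x) = 0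
}.

Arguments cd {R} c i j.

Record chain_map (R : comPzRingType) (X Y : complex R) := ChainMap {
  cmap :> forall i : int, {linear X i -> Y i};
  cmap_cd : forall (i j : int) (x : X i),
    cmap j (cd X i j x) = cd Y i j (cmap i x)
}.

Section ChainMaps.
Context {R : comPzRingType}.
Implicit Types X Y Z : complex R.

Lemma cid_cd X (i j : int) (x : X i) :
  (idfun : {linear X j -> X j}) (cd X i j x)
  = cd X i j ((idfun : {linear X i -> X i}) x).
Proof. by []. Qed.

Definition chain_id X : chain_map X X :=
  @ChainMap R X X (fun i => idfun) (@cid_cd X).

Lemma ccomp_cd X Y Z (g : chain_map Y Z) (f : chain_map X Y) (i j : int)
    (x : X i) :
  (g j \o f j : {linear X j -> Z j}) (cd X i j x)
  = cd Z i j ((g i \o f i : {linear X i -> Z i}) x).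
Proof. by rewrite /= !cmap_cd. Qed.

Definition chain_comp X Y Z (g : chain_map Y Z) (f : chain_map X Y) :
  chain_map X Z :=
  @ChainMap R X Z (fun i => g i \o f i) (ccomp_cd g f).

Lemma czero_cd X Y (i j : int) (x : X i) :
  (\0 : {linear X j -> Y j}) (cd X i j x)
  = cd Y i j ((\0 : {linear X i -> Y i}) x).
Proof. by rewrite /= linear0. Qed.

Definition chain_zero X Y : chain_map X Y :=
  @ChainMap R X Y (fun i => \0) (@czero_cd X Y).

Definition homotopic X Y (f g : chain_map X Y) : Prop :=
  exists h : forall i j : int, {linear X i -> Y j},
    forall (i : int) (x : X i),
      f i x - g i x = cd Y (i - 1) i (h i (i - 1) x)
                      + h (i + 1) i (cd X i (i + 1) x).

Definition cocycle X (i : int) (x : X i) : Prop := forall j, cd X i j x = 0.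

Definition coboundary X (i : int) (x : X i) : Prop :=
  exists (j : int) (w : X j), cd X j i w = x.

(* Injectivity and surjectivity of the maps induced on cohomology. *)
Definition quasi_iso X Y (f : chain_map X Y) : Prop :=
  (forall (i : int) (x : X i), cocycle x -> coboundary (f i x) -> coboundary x)
  /\
  (forall (i : int) (y : Y i), cocycle y ->
     exists2 x : X i, cocycle x & coboundary (f i x - y)).

End ChainMaps.

(* [D(R)] is the localisation of the homotopy category of complexes at the
  quasi-isomorphisms. Its morphisms are the formal composites of chain maps
  and formal inverses of quasi-isomorphisms, identified along [deq], the
  least congruence making [D(R)] a category, making [dmap] a functor that
  identifies homotopic maps, and making [dinv] a two-sided inverse. *)

Inductive dhom (R : comPzRingType) : complex R -> complex R -> Type :=
| dmap X Y (f : chain_map X Y) : dhom X Y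
| dinv X Y (s : chain_map X Y) (qs : quasi_iso s) : dhom Y X
| dcomp X Y Z (g : dhom Y Z) (f : dhom X Y) : dhom X Z.

Definition did (R : comPzRingType) (X : complex R) : dhom X X :=
  dmap (chain_id X).
Definition dzero (R : comPzRingType) (X Y : complex R) : dhom X Y :=
  dmap (chain_zero X Y).

Inductive deq (R : comPzRingType) :
  forall X Y : complex R, dhom X Y -> dhom X Y -> Prop :=
| deq_refl X Y (f : dhom X Y) : deq f f
| deq_sym X Y (f g : dhom X Y) : deq f g -> deq g f
| deq_trans X Y (f g h : dhom X Y) : deq f g -> deq g h -> deq f h
| deq_comp X Y Z (g g' : dhom Y Z) (f f' : dhom X Y) :
    deq g g' -> deq f f' -> deq (dcomp g f) (dcomp g' f')
| deq_assoc W X Y Z (h : dhom Y Z) (g : dhom X Y) (f : dhom W X) :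
    deq (dcomp h (dcomp g f)) (dcomp (dcomp h g) f)
| deq_idl X Y (f : dhom X Y) : deq (dcomp (did Y) f) f
| deq_idr X Y (f : dhom X Y) : deq (dcomp f (did X)) f
| deq_map_comp X Y Z (g : chain_map Y Z) (f : chain_map X Y) :
    deq (dcomp (dmap g) (dmap f)) (dmap (chain_comp g f))
| deq_homotopic X Y (f g : chain_map X Y) :
    homotopic f g -> deq (dmap f) (dmap g)
| deq_invl X Y (s : chain_map X Y) (qs : quasi_iso s) :
    deq (dcomp (dinv qs) (dmap s)) (did X)
| deq_invr X Y (s : chain_map X Y) (qs : quasi_iso s) :
    deq (dcomp (dmap s) (dinv qs)) (did Y).

Definition d_is_iso (R : comPzRingType) (X Y : complex R) (f : dhom X Y) :
  Prop :=
  exists2 g : dhom Y X, deq (dcomp g f) (did X) & deq (dcomp f g) (did Y).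

Definition d_isomorphic (R : comPzRingType) (X Y : complex R) : Prop :=
  exists f : dhom X Y, d_is_iso f.

Section ZeroComplex.
Variable R : comPzRingType.

Let zobj (i : int) : lmodType R := 'rV[R]_0.

Lemma zero_shape (i j : int) (x : zobj i) :
  i + 1 != j -> (\0 : {linear zobj i -> zobj j}) x = 0.
Proof. by []. Qed.

Lemma zero_dd (i j k : int) (x : zobj i) :
  (\0 : {linear zobj j -> zobj k}) ((\0 : {linear zobj i -> zobj j}) x) = 0.
Proof. by []. Qed.

Definition zero_complex : complex R :=
  @Complex R zobj (fun i j => \0) zero_shape zero_dd.
End ZeroComplex.

(* [(shift k X)^i = X^(i+k)], with differential [(-1)^k d] *)

Section Shift.
Context {R : comPzRingType}.
Variable k : int.

Section Obj.
Variable X : complex R.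

Definition shift_cd (i j : int) : {linear X (i + k) -> X (j + k)} :=
  ((-1) ^+ `|k|%N : R) \*: cd X (i + k) (j + k).

Lemma shift_shape (i j : int) (x : X (i + k)) :
  i + 1 != j -> shift_cd i j x = 0.
Proof.
by move=> ij; rewrite /= cd_shape ?scaler0// addrAC (inj_eq (addIr _)).
Qed.

Lemma shift_dd (i j l : int) (x : X (i + k)) :
  shift_cd j l (shift_cd i j x) = 0.
Proof. by rewrite /= linearZ /= cd_cd !scaler0. Qed.

Definition shift : complex R :=
  @Complex R (fun i => X (i + k)) shift_cd shift_shape shift_dd.
End Obj.

Section Map.
Variables (X Y : complex R) (f : chain_map X Y).

Lemma shift_map_cd (i j : int) (x : shift X i) :
  f (j + k) (cd (shift X) i j x) = cd (shift Y) i j (f (i + k) x).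
Proof. by rewrite /= linearZ /= cmap_cd. Qed.

Definition shift_map : chain_map (shift X) (shift Y) :=
  @ChainMap R (shift X) (shift Y) (fun i => f (i + k)) shift_map_cd.
End Map.

Lemma shift_sign_inj (M : lmodType R) (x : M) :
  ((-1) ^+ `|k|%N : R) *: ((-1) ^+ `|k|%N *: x) = x.
Proof. by rewrite scalerA -expr2 sqrr_sign scale1r. Qed.

Lemma shift_cocycle (X : complex R) (i : int) (x : X (i + k)) :
  @cocycle R (shift X) i x <-> @cocycle R X (i + k) x.
Proof.
split=> [cx j|cx j]; last by rewrite /= cx scaler0.
have -> : j = j - k + k by rewrite subrK.
rewrite -[LHS]shift_sign_inj; have /= -> := cx (j - k).
by rewrite scaler0.
Qed.

Lemma shift_coboundary (X : complex R) (i : int) (x : X (i + k)) :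
  @coboundary R (shift X) i x <-> @coboundary R X (i + k) x.
Proof.
split=> [[j [w <-]]|[j [w <-]]].
  by exists (j + k), ((-1) ^+ `|k|%N *: w); rewrite linearZ.
move: w; have -> : j = j - k + k by rewrite subrK.
move=> w; exists (j - k), ((-1) ^+ `|k|%N *: w).
by rewrite /= linearZ /= shift_sign_inj.
Qed.

Lemma shift_quasi_iso (X Y : complex R) (f : chain_map X Y) :
  quasi_iso f -> quasi_iso (shift_map f).
Proof.
case=> finj fsurj; split=> [i x /shift_cocycle cx /shift_coboundary bx|i y].
  by apply/shift_coboundary; apply: finj cx bx.
move=> /shift_cocycle /fsurj[x cx bx].
by exists x; [apply/shift_cocycle | apply/shift_coboundary].
Qed.

Fixpoint dshift (X Y : complex R) (f : dhom X Y) : dhom (shift X) (shift Y) :=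
  match f in dhom X Y return dhom (shift X) (shift Y) with
  | dmap _ _ f => dmap (shift_map f)
  | dinv _ _ _ qs => dinv (shift_quasi_iso qs)
  | dcomp _ _ _ g f => dcomp (dshift g) (dshift f)
  end.

End Shift.

(* The identity of [X^i] when [i = j], and zero otherwise. *)
Section Ctrans.
Context {R : comPzRingType}.
Variables (X : int -> lmodType R) (i j : int).

Definition ctrans (x : X i) : X j :=
  if i =P j is ReflectT e then ecast l (X l) e x else 0.

Lemma ctrans_is_linear : linear ctrans.
Proof.
rewrite /ctrans => a x y; case: eqP => [e|_]; last by rewrite scaler0 addr0.
by case: _ / e.
Qed.

HB.instance Definition _ :=
  GRing.isLinear.Build R (X i) (X j) _ ctrans ctrans_is_linear.
End Ctrans.

Arguments ctrans {R} X i j x.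

Lemma ctrans_id (R : comPzRingType) (X : int -> lmodType R) (i : int)
  (x : X i) : ctrans X i i x = x.
Proof. by rewrite /ctrans; case: eqP => // e; rewrite eq_axiomK. Qed.

Section Cone.
Context {R : comPzRingType}.
Variables (A B : complex R) (u : chain_map A B).

Let obj (i : int) : lmodType R := (A (i + 1)%R * B i)%type.

(* [d (a, b) = (- d a, u a + d b)] *)
Definition cone_fun (i j : int) (p : obj i) : obj j :=
  (- cd A (i + 1) (j + 1) p.1,
   ctrans B (i + 1) j (u (i + 1) p.1) + cd B i j p.2).

Lemma cone_fun_linear i j : linear (@cone_fun i j).
Proof.
move=> a p q; rewrite /cone_fun; congr pair.
  by rewrite /= linearP /= opprD scalerN.
by rewrite /= !linearP /= scalerDr addrACA.
Qed.

HB.instance Definition _ (i j : int) :=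
  GRing.isLinear.Build R (obj i) (obj j) _ (@cone_fun i j)
    (@cone_fun_linear i j).

Lemma cone_shape (i j : int) (p : obj i) :
  i + 1 != j -> cone_fun j p = 0.
Proof.
move=> ij; rewrite /cone_fun !cd_shape ?(inj_eq (addIr _))// oppr0 addr0.
by rewrite /ctrans; case: eqP => // e; rewrite e eqxx in ij.
Qed.

Lemma cone_dd (i j l : int) (p : obj i) : cone_fun l (cone_fun j p) = 0.
Proof.
have [ij|ij] := eqVneq (i + 1) j; last first.
  by rewrite (cone_shape p ij); apply: (linear0 (@cone_fun j l)).
have [jl|jl] := eqVneq (j + 1) l; last by rewrite cone_shape.
subst j l; rewrite /cone_fun /= !ctrans_id !linearN /= linearD /= !cd_cd.
by rewrite !oppr0 addr0 cmap_cd addNr.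
Qed.

Definition cone : complex R :=
  @Complex R obj (fun i j => @cone_fun i j) cone_shape cone_dd.

Definition cone_in_fun (i : int) (b : B i) : cone i := (0, b).

Lemma cone_in_linear i : linear (@cone_in_fun i).
Proof.
by move=> a x y; rewrite /cone_in_fun; congr pair; rewrite /= scaler0 addr0.
Qed.

HB.instance Definition _ (i : int) :=
  GRing.isLinear.Build R (B i) (cone i) _ (@cone_in_fun i) (@cone_in_linear i).

Lemma cone_in_cd (i j : int) (b : B i) :
  cone_in_fun (cd B i j b) = cd cone i j (cone_in_fun b).
Proof. by rewrite /cone_in_fun /= /cone_fun /= !linear0 add0r. Qed.

Definition cone_in : chain_map B cone :=
  @ChainMap R B cone (fun i => @cone_in_fun i) cone_in_cd.

Definition cone_out_fun (i : int) (p : cone i) : shift 1 A i := p.1.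

Lemma cone_out_linear i : linear (@cone_out_fun i).
Proof. by []. Qed.

HB.instance Definition _ (i : int) :=
  GRing.isLinear.Build R (cone i) (shift 1 A i) _ (@cone_out_fun i)
    (@cone_out_linear i).

Lemma cone_out_cd (i j : int) (p : cone i) :
  cone_out_fun (cd cone i j p) = cd (shift 1 A) i j (cone_out_fun p).
Proof. by rewrite /cone_out_fun /= expr1 scaleN1r. Qed.

Definition cone_out : chain_map cone (shift 1 A) :=
  @ChainMap R cone (shift 1 A) (fun i => @cone_out_fun i) cone_out_cd.
End Cone.

Definition distinguished (R : comPzRingType) (X Y Z : complex R)
    (f : dhom X Y) (g : dhom Y Z) (h : dhom Z (shift 1 X)) : Prop :=
  exists (A B : complex R) (u : chain_map A B)
         (a : dhom A X) (b : dhom B Y) (c : dhom (cone u) Z),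
    [/\ d_is_iso a, d_is_iso b & d_is_iso c] /\
    [/\ deq (dcomp f a) (dcomp b (dmap u)),
        deq (dcomp g b) (dcomp c (dmap (cone_in u)))
      & deq (dcomp h c) (dcomp (dshift 1 a) (dmap (cone_out u)))].

Definition d_coproduct (R : comPzRingType) (I : Type) (Y : I -> complex R)
    (C : complex R) (inj : forall a, dhom (Y a) C) : Prop :=
  forall (Z : complex R) (f : forall a, dhom (Y a) Z),
    (exists h : dhom C Z, forall a, deq (dcomp h (inj a)) (f a)) /\
    (forall h h' : dhom C Z,
       (forall a, deq (dcomp h (inj a)) (f a)) ->
       (forall a, deq (dcomp h' (inj a)) (f a)) -> deq h h').

(* A full subcategory is given by its class of objects. *)
Record localising (R : comPzRingType) (L : complex R -> Prop) : Prop :=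
  Localising {
  loc_zero : L (zero_complex R);
  loc_iso : forall X Y, d_isomorphic X Y -> L X -> L Y;
  loc_shift : forall (k : int) X, L X -> L (shift k X);
  loc_triangle : forall X Y Z (f : dhom X Y) (g : dhom Y Z)
    (h : dhom Z (shift 1 X)), distinguished f g h -> L X -> L Y -> L Z;
  loc_coproduct : forall (I : Type) (Y : I -> complex R) (C : complex R)
    (inj : forall a, dhom (Y a) C),
    d_coproduct inj -> (forall a, L (Y a)) -> L C
}.

(* [tens_obj X Y n] is the direct sum of the [X^i (x) Y^j] over [i + j = n].
  Its elements are formal sums of symbols [(i, j, x, y)], identified when
  every family of bilinear maps [X^i x Y^j -> P] that vanishes outside total
  degree [n] takes the same value on them. [tens_lift] and [tens_ext] below
  state its universal property. *)

Section Tensor.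
Context {R : comPzRingType}.
Variables X Y : complex R.

Record bilinear_family (n : int) (P : lmodType R)
    (b : forall i j : int, X i -> Y j -> P) : Prop := BilinearFamily {
  bf_linl : forall i j (y : Y j), linear (fun x => b i j x y);
  bf_linr : forall i j (x : X i), linear (b i j x);
  bf_deg : forall i j (x : X i) (y : Y j), i + j != n -> b i j x y = 0
}.

Definition word : Type := seq {p : int * int & (X p.1 * Y p.2)%type}.
HB.instance Definition _ := Choice.on word.

Definition gen (i j : int) (x : X i) (y : Y j) :
  {p : int * int & (X p.1 * Y p.2)%type} :=
  existT (fun p : int * int => (X p.1 * Y p.2)%type) (i, j) (x, y).

Definition weval (P : lmodType R) (b : forall i j : int, X i -> Y j -> P)
    (w : word) : P :=
  \sum_(g <- w) b (tag g).1 (tag g).2 (tagged g).1 (tagged g).2.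

Section Degree.
Variable n : int.

Definition weqP (w w' : word) : Prop :=
  forall (P : lmodType R) (b : forall i j : int, X i -> Y j -> P),
    bilinear_family n b -> weval b w = weval b w'.

Definition weq (w w' : word) : bool := `[< weqP w w' >].

Lemma weq_equiv : equiv_class_of weq.
Proof.
split=> [w|w w'|w w' w''].
- exact/asboolP.
- by apply/asboolP/asboolP => e P b hb; rewrite e.
- by move=> /asboolP e1 /asboolP e2; apply/asboolP => P b hb; rewrite e1// e2.
Qed.

Canonical weq_rel := EquivRelPack weq_equiv.

Definition tens_obj : Type := {eq_quot weq_rel}%qT.
HB.instance Definition _ := Choice.on tens_obj.
HB.instance Definition _ := EqQuotient.on tens_obj.

Local Notation "\w w" := (\pi_tens_obj w)%qT (at level 8).

Lemma tens_eqP (w w' : word) : \w w = \w w' <-> weqP w w'.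
Proof.
by split=> [/eqmodP /asboolP //|e]; apply/eqmodP/asboolP.
Qed.

Lemma weval_repr (w : word) (P : lmodType R) b :
  @bilinear_family n P b -> weval b (repr (\w w)) = weval b w.
Proof.
have /tens_eqP e : \w (repr (\w w)) = \w w by rewrite reprK.
exact: e.
Qed.

Definition wscale (a : R) (w : word) : word :=
  [seq gen (a *: (tagged g).1) (tagged g).2 | g <- w].

Lemma weval_cat (P : lmodType R) b (w w' : word) :
  @weval P b (w ++ w') = weval b w + weval b w'.
Proof. by rewrite /weval big_cat. Qed.

Lemma weval_scale (P : lmodType R) b a (w : word) :
  @bilinear_family n P b -> weval b (wscale a w) = a *: weval b w.
Proof.
move=> hb; rewrite /weval big_map scaler_sumr; apply: eq_bigr => g _ /=.
have := bf_linl hb (tagged g).2 a (tagged g).1 0.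
have := bf_linl hb (i := (tag g).1) (tagged g).2 (-1) 0 0.
by rewrite scaler0 !addr0 scaleN1r addNr => -> ->; rewrite addr0.
Qed.

Definition tens_zero : tens_obj := \w [::].
Definition tens_add (s t : tens_obj) : tens_obj := \w (repr s ++ repr t).
Definition tens_scale (a : R) (t : tens_obj) : tens_obj :=
  \w (wscale a (repr t)).
Definition tens_opp (t : tens_obj) : tens_obj := tens_scale (-1) t.

Lemma tens_ind_eq (s t : tens_obj) :
  weqP (repr s) (repr t) -> s = t.
Proof. by move/tens_eqP; rewrite !reprK. Qed.

Lemma ev_zero (P : lmodType R) b : @bilinear_family n P b ->
  weval b (repr tens_zero) = 0.
Proof. by move=> hb; rewrite weval_repr// /weval big_nil. Qed.

Lemma ev_add (P : lmodType R) b s t : @bilinear_family n P b ->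
  weval b (repr (tens_add s t)) = weval b (repr s) + weval b (repr t).
Proof. by move=> hb; rewrite weval_repr// weval_cat. Qed.

Lemma ev_scale (P : lmodType R) b a t : @bilinear_family n P b ->
  weval b (repr (tens_scale a t)) = a *: weval b (repr t).
Proof. by move=> hb; rewrite weval_repr// weval_scale. Qed.

Lemma tens_addA : associative tens_add.
Proof.
by move=> r s t; apply: tens_ind_eq => P b hb; rewrite !ev_add// addrA.
Qed.

Lemma tens_addC : commutative tens_add.
Proof.
by move=> s t; apply: tens_ind_eq => P b hb; rewrite !ev_add// addrC.
Qed.

Lemma tens_add0 : left_id tens_zero tens_add.
Proof.
by move=> t; apply: tens_ind_eq => P b hb; rewrite ev_add// ev_zero// add0r.
Qed.

Lemma tens_addN : left_inverse tens_zero tens_opp tens_add.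
Proof.
move=> t; apply: tens_ind_eq => P b hb.
by rewrite ev_add// ev_scale// ev_zero// scaleN1r addNr.
Qed.

HB.instance Definition _ :=
  GRing.isZmodule.Build tens_obj tens_addA tens_addC tens_add0 tens_addN.

Lemma tens_scaleA a a' t :
  tens_scale a (tens_scale a' t) = tens_scale (a * a') t.
Proof.
by apply: tens_ind_eq => P b hb; rewrite !ev_scale// scalerA.
Qed.

Lemma tens_scale1 : left_id 1 tens_scale.
Proof. by move=> t; apply: tens_ind_eq => P b hb; rewrite ev_scale// scale1r. Qed.

Lemma tens_scaleDr : right_distributive tens_scale +%R.
Proof.
move=> a s t; apply: tens_ind_eq => P b hb.
by rewrite ev_scale// !ev_add// !ev_scale// scalerDr.
Qed.

Lemma tens_scaleDl t : {morph tens_scale^~ t : a a' / a + a'}.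
Proof.
move=> a a'; apply: tens_ind_eq => P b hb.
by rewrite ev_scale// ev_add// !ev_scale// scalerDl.
Qed.

HB.instance Definition _ :=
  GRing.Zmodule_isLmodule.Build R tens_obj
    tens_scaleA tens_scale1 tens_scaleDr tens_scaleDl.

(* The image of [x (x) y] in degree [n], which is zero unless [i + j = n]. *)
Definition tens (i j : int) (x : X i) (y : Y j) : tens_obj :=
  \w [:: gen x y].

Lemma ev_tens (P : lmodType R) b i j (x : X i) (y : Y j) :
  @bilinear_family n P b -> weval b (repr (tens x y)) = b i j x y.
Proof. by move=> hb; rewrite weval_repr// /weval big_seq1. Qed.

Lemma tens_bilinear : @bilinear_family n tens_obj tens.
Proof.
split=> [i j y a x x'|i j x a y y'|i j x y ij]; apply: tens_ind_eq => P b hb.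
- by rewrite ev_add// ev_scale// !ev_tens// (bf_linl hb).
- by rewrite ev_add// ev_scale// !ev_tens// (bf_linr hb).
- by rewrite ev_zero// ev_tens// (bf_deg hb).
Qed.

Section Lift.
Variables (P : lmodType R) (b : forall i j : int, X i -> Y j -> P).
Hypothesis hb : bilinear_family n b.

Definition tens_lift_fun & bilinear_family n b : tens_obj -> P :=
  fun t => weval b (repr t).

Lemma tens_lift_linear : linear (tens_lift_fun hb).
Proof. by move=> a s t; rewrite /tens_lift_fun ev_add// ev_scale. Qed.

HB.instance Definition _ :=
  GRing.isLinear.Build R tens_obj P _ (tens_lift_fun hb) tens_lift_linear.

Definition tens_lift : {linear tens_obj -> P} := tens_lift_fun hb.

Lemma tens_liftE i j (x : X i) (y : Y j) : tens_lift (tens x y) = b x y.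
Proof. exact: ev_tens. Qed.
End Lift.

Lemma tens_sum (t : tens_obj) :
  t = \sum_(g <- repr t) tens (tagged g).1 (tagged g).2.
Proof.
apply: tens_ind_eq => P b hb.
have E : weval b (repr (\sum_(g <- repr t) tens (tagged g).1 (tagged g).2))
         = tens_lift hb (\sum_(g <- repr t) tens (tagged g).1 (tagged g).2).
  by [].
by rewrite E linear_sum; apply: eq_bigr => g _; rewrite tens_liftE.
Qed.

Lemma tens_ext (P : lmodType R) (f g : {linear tens_obj -> P}) :
  (forall i j (x : X i) (y : Y j), f (tens x y) = g (tens x y)) -> f =1 g.
Proof.
move=> fg t; rewrite (tens_sum t) !linear_sum; apply: eq_bigr => w _.
exact: fg.
Qed.

End Degree.

(* [d (x (x) y) = d x (x) y + (-1)^i x (x) d y] for [x] of degree [i]. *)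
Definition tens_d_family (n m : int) (i j : int) (x : X i) (y : Y j) :
  tens_obj m :=
  if n + 1 == m then
    tens m (cd X i (i + 1) x) y
    + ((-1) ^+ `|i|%N : R) *: tens m x (cd Y j (j + 1) y)
  else 0.

Lemma tens_d_bilinear (n m : int) : bilinear_family n (tens_d_family n m).
Proof.
have tb := tens_bilinear m.
rewrite /tens_d_family; case: eqP => [nm|_]; last first.
  by split=> [i j y a x x'|i j x a y y'|//]; rewrite /= scaler0 addr0.
split=> [i j y a x x'|i j x a y y'|i j x y ij].
- rewrite linearP (bf_linl tb) (bf_linl tb) !scalerDr !scalerA.
  by rewrite [_ * a]mulrC addrACA.
- rewrite linearP (bf_linr tb) (bf_linr tb) !scalerDr !scalerA.
  by rewrite [_ * a]mulrC addrACA.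
- rewrite !(bf_deg tb) ?scaler0 ?addr0// -nm.
    by rewrite addrA (inj_eq (addIr _)).
  by rewrite addrAC (inj_eq (addIr _)).
Qed.

Definition tens_d (n m : int) : {linear tens_obj n -> tens_obj m} :=
  tens_lift (tens_d_bilinear n m).

Lemma tens_shape (n m : int) (t : tens_obj n) : n + 1 != m -> tens_d n m t = 0.
Proof.
move=> nm; rewrite -[RHS]/((\0 : {linear tens_obj n -> tens_obj m}) t).
apply: tens_ext => i j x y.
by rewrite tens_liftE /tens_d_family (negbTE nm).
Qed.

Lemma sign_succ (i : int) : (-1) ^+ `|(i + 1)%R|%N = - (-1) ^+ `|i|%N :> R.
Proof.
case: i => n; first by rewrite -PoszD addn1 /= exprS mulN1r.
rewrite NegzE abszN -[in LHS]addn1 PoszD opprD subrK abszN /=.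
by rewrite exprS mulN1r opprK.
Qed.

Lemma tens_dd (n m l : int) (t : tens_obj n) : tens_d m l (tens_d n m t) = 0.
Proof.
have [nm|nm] := eqVneq (n + 1) m; last by rewrite (tens_shape t nm) linear0.
have [ml|ml] := eqVneq (m + 1) l; last exact: tens_shape.
have tb := tens_bilinear l.
have t0l i j (y : Y j) : tens l (0 : X i) y = 0.
  by have := bf_linl tb (i := i) y (-1) 0 0; rewrite scaler0 addr0 scaleN1r addNr.
have t0r i j (x : X i) : tens l x (0 : Y j) = 0.
  by have := bf_linr tb (j := j) x (-1) 0 0; rewrite scaler0 addr0 scaleN1r addNr.
rewrite -[LHS]/((tens_d m l \o tens_d n m : {linear _ -> _}) t).
rewrite -[RHS]/((\0 : {linear tens_obj n -> tens_obj l}) t).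
apply: tens_ext => i j x y /=.
rewrite tens_liftE /tens_d_family nm eqxx linearD linearZ !tens_liftE.
rewrite /tens_d_family ml eqxx !cd_cd t0l t0r scaler0 addr0 add0r sign_succ.
by rewrite scaleNr addNr.
Qed.

Definition tensor : complex R :=
  @Complex R (fun n => tens_obj n) tens_d tens_shape tens_dd.
End Tensor.

(* Over an absolutely flat ring every module is flat, so every complex is
  K-flat and [tensor] computes the tensor product of [D(R)]. *)

Definition bousfield_class (R : comPzRingType) (L : complex R -> Prop) : Prop :=
  exists X : complex R, forall Y : complex R,
    L Y <-> d_isomorphic (tensor X Y) (zero_complex R).

Definition cohomological_bousfield_class (R : comPzRingType)
    (L : complex R -> Prop) : Prop :=
  exists X : complex R, forall Y : complex R,
    L Y <-> forall (i : int) (f : dhom Y (shift i X)), deq f (dzero Y (shift i X)).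

(* Main.v *)
Require Import Defs.
From HB Require Import structures.
From mathcomp Require Import all_boot all_order all_algebra.
From mathcomp Require Import boolp classical_sets.

(** A Bousfield class that contains every residue field of [R] is the whole
  derived category: if [X (x) R/m] is acyclic for all maximal ideals [m], then
  so is [X], because over an absolutely flat ring tensoring with [R/m] is
  localisation at [m] ([residue_fields_detect_acyclic]). So it suffices to find
  a nonzero object with no morphisms, in any degree, from any residue field:
  the objects that map trivially to all its shifts form a proper cohomological
  Bousfield class that contains all residue fields.

  As [R] is not semi-artinian, it has a nonzero cyclic module [M] without simple
  submodules, that is, without nonzero elements killed by a maximal ideal
  ([maximal_torsion_free]). The injective hull [E] of [M] inherits this, and
  then [Hom (R/m, E[i])] is zero for all [i]. The hull is built by hand as the
  module of quotients of [M], the colimit of [Hom (D, M)] over the ideals [D]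
  that annihilate no nonzero element of [M]; absolute flatness of [R] makes it
  injective ([quotients_injective]). It contains [M], so it receives a nonzero
  map from [R] ([regular_module_not_orthogonal]).

  Morphisms of the derived category are formal composites, and two facts give
  access to them. They act on cohomology, compatibly with the congruence [deq]
  ([hrel_deq]), so chain maps that are distinct on cohomology stay distinct. And
  every morphism into an injective module placed in one degree comes from a
  chain map, unique up to homotopy ([dhom_conc_chain_map],
  [homotopic_on_cocycles]). Together they show that [Y] has no morphisms to the
  shifts of [E] exactly when every functional on the terms of [Y] that kills
  coboundaries kills cocycles ([conc_orthogonalP]), which is a condition that
  can be checked on residue fields, shifts and cones. *)

Set Implicit Arguments.
Unset Strict Implicit.
Unset Printing Implicit Defensive.

Import GRing.Theory.
Local Open Scope ring_scope.

(** * Cohomology of morphisms of the derived category *)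

Section CohomologyOfMorphisms.
Context {R : comPzRingType}.
Implicit Types W X Y Z : complex R.

Lemma coboundary0 X i : coboundary (0 : X i).
Proof. by exists i, 0; rewrite linear0. Qed.

Lemma coboundaryP X i j (x : X j) :
  i + 1 = j -> coboundary x -> exists w : X i, cd X i j w = x.
Proof.
move=> ij [k [w <-]]; have [/eqP kj|kj] := boolP (k + 1 == j); last first.
  by exists 0; rewrite linear0 cd_shape.
have ki : k = i by apply: (@addIr _ 1); rewrite ij.
by move: w; rewrite {}ki => w; exists w.
Qed.

Lemma coboundaryD X i (x y : X i) :
  coboundary x -> coboundary y -> coboundary (x + y).
Proof.
move=> /(coboundaryP (subrK 1 i))[w <-] /(coboundaryP (subrK 1 i))[v <-].
by exists (i - 1), (w + v); rewrite linearD.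
Qed.

Lemma coboundaryZ X i a (x : X i) : coboundary x -> coboundary (a *: x).
Proof. by case=> j [w <-]; exists j, (a *: w); rewrite linearZ. Qed.

Lemma coboundaryN X i (x : X i) : coboundary x -> coboundary (- x).
Proof. by move=> /(coboundaryZ (-1)); rewrite scaleN1r. Qed.

Lemma coboundary_trans X i (x y z : X i) :
  coboundary (x - y) -> coboundary (y - z) -> coboundary (x - z).
Proof. by move=> xy /(coboundaryD xy); rewrite addrA subrK. Qed.

Lemma coboundary_sym X i (x y : X i) : coboundary (x - y) -> coboundary (y - x).
Proof. by move=> /coboundaryN; rewrite opprB. Qed.

Lemma cocycleD X i (x y : X i) : cocycle x -> cocycle y -> cocycle (x + y).
Proof. by move=> cx cy j; rewrite linearD cx cy addr0. Qed.

Lemma cocycleZ X i a (x : X i) : cocycle x -> cocycle (a *: x).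
Proof. by move=> cx j; rewrite linearZ /= cx scaler0. Qed.

Lemma cocycleB X i (x y : X i) : cocycle x -> cocycle y -> cocycle (x - y).
Proof. by move=> cx cy; rewrite -scaleN1r; apply/cocycleD/cocycleZ. Qed.

Lemma cocycle0 X i : cocycle (0 : X i).
Proof. by move=> j; rewrite linear0. Qed.

Lemma cmap_cocycle X Y (f : chain_map X Y) i (x : X i) :
  cocycle x -> cocycle (f i x).
Proof. by move=> cx j; rewrite -cmap_cd cx linear0. Qed.

Lemma cmap_coboundary X Y (f : chain_map X Y) i (x : X i) :
  coboundary x -> coboundary (f i x).
Proof. by case=> j [w <-]; exists j, (f j w); rewrite cmap_cd. Qed.

Definition acyclic X := forall i (x : X i), cocycle x -> coboundary x.

(** The map induced by [f] on cohomology, as a relation between representing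
  cocycles: formal inverses then need no choice of preimages. *)
Fixpoint hrel X Y (f : dhom X Y) (i : int) : X i -> Y i -> Prop :=
  match f in dhom X Y return X i -> Y i -> Prop with
  | dmap _ _ f => fun x y => coboundary (f i x - y)
  | dinv _ _ s _ => fun y x => coboundary (s i x - y)
  | dcomp _ _ _ g f => fun x z =>
      exists y, [/\ cocycle y, hrel f x y & hrel g y z]
  end.

Lemma hrel_coboundary X Y (f : dhom X Y) i (x x' : X i) (y y' : Y i) :
  coboundary (x - x') -> coboundary (y - y') -> hrel f x y -> hrel f x' y'.
Proof.
move: x x' y y'; elim: f => {X Y} [X Y f|X Y s qs|X Y Z g IHg f IHf] x x' y y'.
- move=> xx yy /= xy; apply: (coboundary_trans _ yy).
  apply: (coboundary_trans _ xy); rewrite -linearB.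
  exact/cmap_coboundary/coboundary_sym.
- move=> xx yy /= xy; apply: (coboundary_trans _ xx).
  apply: (coboundary_trans _ xy); rewrite -linearB.
  exact/cmap_coboundary/coboundary_sym.
- move=> xx yy [z [cz xz zy]]; exists z; split=> //.
    by apply: IHf xz => //; rewrite subrr; apply: coboundary0.
  by apply: IHg zy => //; rewrite subrr; apply: coboundary0.
Qed.

(** The relation is the graph of the functor of cohomology; for the two
  cancellation laws this is where the injectivity and the surjectivity of
  quasi-isomorphisms on cohomology are used. *)
Lemma hrel_deq X Y (f g : dhom X Y) : deq f g ->
  forall i (x : X i) (y : Y i), cocycle x -> cocycle y ->
    hrel f x y <-> hrel g x y.
Proof.
have b0 X' i (x : X' i) : coboundary (x - x).
  by rewrite subrr; apply: coboundary0.
elim=> {X Y f g} /=.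
- by [].
- by move=> X Y f g _ IH i x y cx cy; rewrite IH.
- by move=> X Y f g h _ IH _ IH' i x y cx cy; rewrite IH// IH'.
- move=> X Y Z g g' f f' _ IHg _ IHf i x z cx cz.
  by split=> -[y [cy xy yz]]; exists y; split=> //;
    [apply/IHf|apply/IHg|apply/IHf|apply/IHg].
- move=> W X Y Z h g f i w z cw cz; split.
    by case=> y [cy [x [cx wx xy]] yz]; exists x; split=> //; exists y.
  by case=> x [cx wx [y [cy xy yz]]]; exists y; split=> //; exists x.
- move=> X Y f i x y cx cy; split=> [[z [cz xz zy]]|xy]; last by exists y.
  exact: hrel_coboundary xz.
- move=> X Y f i x y cx cy; split=> [[z [cz xz zy]]|xy]; last by exists x.
  by apply: hrel_coboundary zy => //; apply: coboundary_sym.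
- move=> X Y Z g f i x z cx cz; split=> [[y [cy xy yz]]|xz].
    by apply: coboundary_trans yz; rewrite -linearB; apply: cmap_coboundary.
  by exists (f i x); split=> //; apply: cmap_cocycle.
- move=> X Y f g [h fgh] i x y cx cy.
  have fg : coboundary (f i x - g i x).
    by rewrite fgh cx linear0 addr0; exists (i - 1), (h i (i - 1) x).
  by split; apply: coboundary_trans => //; apply: coboundary_sym.
- move=> X Y s qs i x y cx cy; split=> [[z [cz xz yz]]|xy].
    apply: qs.1; first exact: cocycleB.
    by rewrite linearB; apply: (coboundary_trans xz); apply: coboundary_sym.
  exists (s i x); split=> //; first exact: cmap_cocycle.
  by rewrite -linearB; apply/cmap_coboundary/coboundary_sym.
- move=> X Y s qs i x y cx cy; split=> [[z [cz xz yz]]|xy].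
    by apply: coboundary_trans yz; apply: coboundary_sym.
  have [z cz zx] := qs.2 i x cx.
  by exists z; split=> //; apply: coboundary_trans xy.
Qed.

Lemma homotopic_eq X Y (f g : chain_map X Y) :
  (forall i x, f i x = g i x) -> homotopic f g.
Proof.
move=> fg; exists (fun i j => \0) => i x.
by rewrite fg subrr /= linear0 addr0.
Qed.

(** A formal inverse preserves the zero morphism because the quasi-isomorphism
  that it inverts does. *)
Lemma dcomp_dzero W X Y (f : dhom X Y) :
  deq (dcomp f (dzero W X)) (dzero W Y).
Proof.
elim: f W => {X Y} [X Y f|X Y s qs|X Y Z g IHg f IHf] W.
- apply: deq_trans (deq_map_comp _ _) _.
  by apply/deq_homotopic/homotopic_eq => i x /=; rewrite linear0.
- have E : deq (dcomp (dmap s) (dzero W X)) (dzero W Y).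
    apply: deq_trans (deq_map_comp _ _) _.
    by apply/deq_homotopic/homotopic_eq => i x /=; rewrite linear0.
  apply: deq_trans (deq_comp (deq_refl _) (deq_sym E)) _.
  apply: deq_trans (deq_assoc _ _ _) _.
  apply: deq_trans (deq_comp (deq_invl qs) (deq_refl _)) _.
  exact: deq_idl.
- apply: deq_trans (deq_sym (deq_assoc _ _ _)) _.
  exact: deq_trans (deq_comp (deq_refl _) (IHf _)) (IHg _).
Qed.

Lemma dzero_dcomp X Y Z (f : dhom X Y) :
  deq (dcomp (dzero Y Z) f) (dzero X Z).
Proof.
elim: f Z => {X Y} [X Y f|X Y s qs|X Y Y' g IHg f IHf] Z.
- apply: deq_trans (deq_map_comp _ _) _.
  exact/deq_homotopic/homotopic_eq.
- have E : deq (dcomp (dzero Y Z) (dmap s)) (dzero X Z).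
    apply: deq_trans (deq_map_comp _ _) _.
    exact/deq_homotopic/homotopic_eq.
  apply: deq_trans (deq_comp (deq_sym E) (deq_refl _)) _.
  apply: deq_trans (deq_sym (deq_assoc _ _ _)) _.
  apply: deq_trans (deq_comp (deq_refl _) (deq_invr qs)) _.
  exact: deq_idr.
- apply: deq_trans (deq_assoc _ _ _) _.
  exact: deq_trans (deq_comp (IHg _) (deq_refl _)) (IHf _).
Qed.

Lemma d_isomorphic_zeroP X : d_isomorphic X (zero_complex R) <-> acyclic X.
Proof.
split=> [[f [g gf _]] i x cx|acX].
  have id0 : deq (did (zero_complex R)) (dzero _ _).
    by apply/deq_homotopic/homotopic_eq => j y; apply/matrixP => ? [].
  have idX0 : deq (did X) (dzero X X).
    apply: deq_trans (deq_sym gf) _.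
    apply: deq_trans (deq_comp (deq_sym (deq_idr g)) (deq_refl f)) _.
    apply: deq_trans (deq_comp (deq_comp (deq_refl g) id0) (deq_refl f)) _.
    apply: deq_trans (deq_comp (dcomp_dzero _ g) (deq_refl f)) _.
    exact: dzero_dcomp.
  have /(hrel_deq idX0 cx cx) /= : hrel (did X) x x.
    by rewrite /= subrr; apply: coboundary0.
  by rewrite sub0r => /coboundaryN; rewrite opprK.
have qs : quasi_iso (chain_zero X (zero_complex R)).
  split=> [i x /acX//|i y _]; exists 0; first exact: cocycle0.
  rewrite (_ : _ - _ = 0); first exact: coboundary0.
  by apply/matrixP => ? [].
by exists (dmap (chain_zero _ _)), (dinv qs); [apply: deq_invl|apply: deq_invr].
Qed.

End CohomologyOfMorphisms.

(** * Morphisms to an injective module in one degree *)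

Section MkLinear.
Variables (R : comPzRingType) (U V : lmodType R) (f : U -> V).

Definition mk_linear_fun & linear f := f.
Hypothesis linf : linear f.

HB.instance Definition _ :=
  GRing.isLinear.Build R U V _ (mk_linear_fun linf) linf.

Definition mk_linear : {linear U -> V} := mk_linear_fun linf.
End MkLinear.

Section Concentrated.
Variables (R : comPzRingType) (M : lmodType R).

(** The degree enters through the boolean test for degree zero, so that
  [conc_in] and [conc_out] reach the term in any degree without a transport
  along an equality of degrees. *)
Definition conc_obj (b : bool) : lmodType R := if b then M else 'rV[R]_0.

Definition conc_in (b : bool) : M -> conc_obj b :=
  if b return M -> conc_obj b then idfun else fun=> 0.

Definition conc_out (b : bool) : conc_obj b -> M :=
  if b return conc_obj b -> M then idfun else fun=> 0.

Lemma conc_in_linear b : linear (@conc_in b).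
Proof. by case: b => a x y //=; rewrite scaler0 addr0. Qed.

HB.instance Definition _ b :=
  GRing.isLinear.Build R M (conc_obj b) _ (@conc_in b) (@conc_in_linear b).

Lemma conc_out_linear b : linear (@conc_out b).
Proof. by case: b => a x y //=; rewrite scaler0 addr0. Qed.

HB.instance Definition _ b :=
  GRing.isLinear.Build R (conc_obj b) M _ (@conc_out b) (@conc_out_linear b).

Lemma conc_inK (b : bool) : b -> cancel (@conc_in b) (@conc_out b).
Proof. by case: b. Qed.

Lemma conc_outK b : cancel (@conc_out b) (@conc_in b).
Proof. by case: b => // x; apply/matrixP => ? []. Qed.

Lemma conc_out0 (b : bool) (x : conc_obj b) : ~~ b -> conc_out x = 0.
Proof. by case: b x. Qed.

Definition conc : complex R :=
  @Complex R (fun i => conc_obj (i == 0)) (fun i j => \0)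
    (fun i j x _ => erefl) (fun i j k x => erefl).

Lemma conc_cd i j (x : conc i) : cd conc i j x = 0.
Proof. by []. Qed.

End Concentrated.

Lemma cocycle_next (R : comPzRingType) (X : complex R) i (x : X i) :
  cd X i (i + 1) x = 0 -> cocycle x.
Proof. by move=> dx j; have [<-//|/cd_shape->] := eqVneq (i + 1) j. Qed.

(** A partial linear map, given by its graph. *)
Definition linear_graph (R : comPzRingType) (M E : lmodType R)
    (G : M -> E -> Prop) : Prop :=
  (forall a x y x' y', G x y -> G x' y' -> G (a *: x + x') (a *: y + y')) /\
  (forall y, G 0 y -> y = 0).

(** Injectivity with partial maps given by graphs: a map can be prescribed on
  elements such as [d y] or [f x] directly, with well-definedness reduced to
  the value at zero. *)
Definition injective_module (R : comPzRingType) (E : lmodType R) : Prop :=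
  forall (M : lmodType R) (G : M -> E -> Prop), linear_graph G ->
  exists g : {linear M -> E}, forall x y, G x y -> g x = y.

Definition hom_vanishing (R : comPzRingType) (E : lmodType R) (Y : complex R) :
  Prop :=
  forall n (phi : {linear Y n -> E}),
    (forall j w, phi (cd Y j n w) = 0) -> forall y, cocycle y -> phi y = 0.

Section InjectiveTarget.
Variables (R : comPzRingType) (E : lmodType R).
Hypothesis injE : injective_module E.

(** The coboundaries of degree [n + 1] are the quotient of [Y n] by the
  cocycles, so [phi] is defined on them; [psi] is an extension. *)
Lemma factor_differential (Y : complex R) n (phi : {linear Y n -> E}) :
  (forall y, cocycle y -> phi y = 0) ->
  exists psi : {linear Y (n + 1) -> E},
    forall y, psi (cd Y n (n + 1) y) = phi y.
Proof.
move=> phi0.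
have [|psi psiP] := injE
  (G := fun z e => exists y, z = cd Y n (n + 1) y /\ e = phi y).
  split=> [a x y x' y' [u [-> ->]] [v [-> ->]]|e [y [dy ->]]].
    by exists (a *: u + v); rewrite !linearP.
  by apply/phi0/cocycle_next.
by exists psi => y; apply: psiP; exists y.
Qed.

Variables (i n : int).
Hypothesis ni : n + i == 0.
Let Z := shift i (conc E).
Let out a (z : Z a) : E := conc_out z.

Let outI a (z z' : Z a) : out z = out z' -> z = z'.
Proof. exact: can_inj (@conc_outK R E _) z z'. Qed.

Let Z_eq a (z z' : Z a) : a != n -> z = z'.
Proof.
move=> an; apply: outI; rewrite /out !conc_out0//.
  by apply: contra_neqN an => /eqP ai; apply: (@addIr _ i); rewrite ai (eqP ni).
by apply: contra_neqN an => /eqP ai; apply: (@addIr _ i); rewrite ai (eqP ni).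
Qed.

Let Z_cd a b (z : Z a) : cd Z a b z = 0.
Proof. by rewrite /= scaler0. Qed.

Section OfFunctional.
Variables (Y : complex R) (phi : {linear Y n -> E}).
Hypothesis phi0 : forall j w, phi (cd Y j n w) = 0.

Definition functional_map_obj a : {linear Y a -> Z a} :=
  @conc_in R E (a + i == 0) \o phi \o ctrans Y a n.

Lemma functional_map_cd a b (y : Y a) :
  functional_map_obj b (cd Y a b y) = cd Z a b (functional_map_obj a y).
Proof.
rewrite Z_cd /functional_map_obj /=; have [->|bn] := eqVneq b n.
  by rewrite ctrans_id phi0 linear0.
by apply: Z_eq.
Qed.

Definition functional_map : chain_map Y Z := ChainMap functional_map_cd.

Lemma functional_mapE y : out (functional_map n y) = phi y.
Proof. by rewrite /out /= ctrans_id conc_inK. Qed.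
End OfFunctional.

(** The difference of the two maps factors through the differential, and the
  factor is a homotopy. *)
Lemma homotopic_on_cocycles (Y : complex R) (f g : chain_map Y Z) :
  (forall y : Y n, cocycle y -> f n y = g n y) -> homotopic f g.
Proof.
move=> fg; pose phi : {linear Y n -> E} :=
  @conc_out R E (n + i == 0) \o (f n \- g n : {linear Y n -> Z n}).
have [y cy|psi psiE] := factor_differential (phi := phi).
  by rewrite /phi /= fg// subrr linear0.
exists (fun a b => @conc_in R E (b + i == 0) \o psi \o ctrans Y a (n + 1)).
move=> a y; have [e|an] := eqVneq a n; last exact: Z_eq.
subst a; rewrite Z_cd add0r /= ctrans_id psiE /phi /=.
by apply: (esym (conc_outK _)).
Qed.

(** Formal inverses can be absorbed: [alpha] induces a map on the cohomology of
  [X], hence on that of [Y] when [s : X -> Y] is a quasi-isomorphism, and this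
  map extends to [Y n] by injectivity. *)
Lemma dhom_conc_chain_map (W V : complex R) (g : dhom W V)
    (alpha : chain_map V Z) :
  exists beta, deq (dcomp (dmap alpha) g) (dmap beta).
Proof.
elim: g alpha => {W V} [X Y f|X Y s qs|W X Y g IHg f IHf] alpha.
- by exists (chain_comp alpha f); apply: deq_map_comp.
- have [|phi phiP] := injE (G := fun (y : Y n) e => exists x : X n,
    [/\ cocycle x, coboundary (s n x - y) & e = out (alpha n x)]).
    split=> [a y e y' e' [x [cx xy ->]] [x' [cx' xy' ->]]|e [x [cx xy ->]]].
      exists (a *: x + x'); split; first exact/cocycleD/cx'/cocycleZ.
        rewrite linearP opprD addrACA -scalerBr.
        exact/coboundaryD/xy'/coboundaryZ.
      by rewrite /out !linearP.
    rewrite subr0 in xy; have [k [w <-]] := qs.1 _ _ cx xy.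
    by rewrite cmap_cd Z_cd /out linear0.
  have phi0 j w : phi (cd Y j n w) = 0.
    apply: phiP; exists 0; split; first exact: cocycle0.
      by rewrite linear0 sub0r; apply: coboundaryN; exists j, w.
    by rewrite /out !linear0.
  exists (functional_map phi0).
  have E1 : deq (dmap (chain_comp (functional_map phi0) s)) (dmap alpha).
    apply/deq_homotopic/homotopic_on_cocycles => x cx.
    apply: outI; rewrite (functional_mapE phi0); apply: phiP.
    by exists x; split=> //; rewrite subrr; apply: coboundary0.
  apply: deq_trans (deq_comp (deq_sym E1) (deq_refl _)) _.
  apply: deq_trans (deq_comp (deq_sym (deq_map_comp _ _)) (deq_refl _)) _.
  apply: deq_trans (deq_sym (deq_assoc _ _ _)) _.
  apply: deq_trans (deq_comp (deq_refl _) (deq_invr qs)) _.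
  exact: deq_idr.
- have [beta betaE] := IHg alpha; have [gamma gammaE] := IHf beta.
  exists gamma; apply: deq_trans (deq_assoc _ _ _) _.
  exact: deq_trans (deq_comp betaE (deq_refl _)) _.
Qed.

(** If all morphisms are zero, a functional that kills coboundaries is, as a
  chain map, zero on cohomology, and the cohomology of the target is the target
  itself. Conversely every morphism is a chain map, null-homotopic as soon as
  it kills cocycles. *)
Lemma dhom_conc_eq0 (Y : complex R) :
  (forall f : dhom Y Z, deq f (dzero Y Z)) <->
  (forall phi : {linear Y n -> E}, (forall j w, phi (cd Y j n w) = 0) ->
     forall y, cocycle y -> phi y = 0).
Proof.
split=> [f0 phi phi0 y cy|phi0 f].
  have := hrel_deq (f0 (dmap (functional_map phi0))) cy
    (cmap_cocycle (functional_map phi0) cy).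
  case=> /= + _; rewrite -/Z subrr => /(_ (coboundary0 _ _)) [j [w]].
  rewrite Z_cd sub0r => /esym/eqP; rewrite oppr_eq0 => /eqP e.
  rewrite -(functional_mapE phi0 y); apply: etrans (congr1 (@out n) e) _.
  by rewrite /out linear0.
have [beta betaE] := dhom_conc_chain_map f (chain_id Z).
apply: deq_trans (deq_sym (deq_idl _)) _; apply: deq_trans betaE _.
apply/deq_homotopic/homotopic_on_cocycles => y cy.
apply: outI; rewrite /= /out linear0.
apply: (phi0 (@conc_out R E (n + i == 0) \o beta n)) => // j w.
by rewrite /= cmap_cd Z_cd linear0.
Qed.

End InjectiveTarget.

Definition conc_orthogonal (R : comPzRingType) (E : lmodType R)
    (Y : complex R) : Prop :=
  forall i (f : dhom Y (shift i (conc E))), deq f (dzero Y (shift i (conc E))).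

Lemma conc_orthogonalP (R : comPzRingType) (E : lmodType R) (Y : complex R) :
  injective_module E -> conc_orthogonal E Y <-> hom_vanishing E Y.
Proof.
move=> injE; split=> [Y0 n phi|Y0 i f].
  have n0 : n + - n == 0 by rewrite subrr.
  exact: (dhom_conc_eq0 injE n0 Y).1 (Y0 (- n)) phi.
have i0 : - i + i == 0 by rewrite addNr.
by apply: (dhom_conc_eq0 injE i0 Y).2 => phi; apply: Y0.
Qed.

(** Exactness of the long cohomology sequence, by hand. A functional [phi] that
  kills the coboundaries of the cone kills the cocycles of [B], so on [B] it is
  [psi d]; subtracting [psi u] from its restriction to [A] gives a functional
  [theta] that kills the coboundaries of [A]. *)
Lemma cone_hom_vanishing (R : comPzRingType) (E : lmodType R)
    (A B : complex R) (u : chain_map A B) :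
  injective_module E -> hom_vanishing E A -> hom_vanishing E B ->
  hom_vanishing E (cone u).
Proof.
move=> injE A0 B0 n phi phi0 [a b] cab.
pose phiB : {linear B n -> E} := phi \o cone_in u n.
have phiB0 j w : phiB (cd B j n w) = 0.
  by rewrite /phiB /= [cone_in_fun _ _]cone_in_cd phi0.
have [psi psiE] := factor_differential injE (B0 n phiB phiB0).
have inl_lin : linear (fun a : A (n + 1) => (a, 0) : cone u n).
  by move=> r x y; congr pair; rewrite /= scaler0 addr0.
have [theta thetaE] : exists theta : {linear A (n + 1) -> E},
    forall x, theta x = phi (x, 0) - psi (u (n + 1) x).
  by exists ((phi \o mk_linear inl_lin) \- (psi \o u (n + 1))).
have phiE : phi (a, b) = phi (a, 0) + phiB b.
  by rewrite /phiB /= -linearD; congr (phi (_, _)); rewrite ?addr0 ?add0r.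
have theta0 j w : theta (cd A j (n + 1) w) = 0.
  have [k e] : exists k, j = k + 1 by exists (j - 1); rewrite subrK.
  subst j; have [e|ne] := eqVneq (k + 1) n; last first.
    by rewrite cd_shape ?linear0// (inj_eq (addIr _)).
  subst n; have /= := phi0 k (w, 0).
  rewrite /cone_fun /= linear0 addr0 ctrans_id => e0.
  rewrite thetaE cmap_cd psiE /phiB /= -linearB /=.
  apply/eqP; rewrite -oppr_eq0 -linearN; apply/eqP; rewrite -[RHS]e0.
  by congr (phi (_, _)); rewrite /= ?subr0 ?sub0r ?opprK.
have := cab (n + 1); rewrite /= /cone_fun /= ctrans_id => -[] da db.
have ca : cocycle a.
  by apply: cocycle_next; apply/eqP; rewrite -oppr_eq0 da.
have := A0 _ theta theta0 a ca; rewrite thetaE => /eqP.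
rewrite subr_eq0 phiE => /eqP ->.
by rewrite -psiE -linearD db linear0.
Qed.

(** * The objects orthogonal to an injective module *)

Lemma d_isomorphic_sym (R : comPzRingType) (X Y : complex R) :
  d_isomorphic X Y -> d_isomorphic Y X.
Proof. by case=> f [g gf fg]; exists g, f. Qed.

Lemma conc_orthogonal_iso (R : comPzRingType) (E : lmodType R)
    (X Y : complex R) :
  d_isomorphic X Y -> conc_orthogonal E X -> conc_orthogonal E Y.
Proof.
case=> f [g _ fg] X0 i h.
apply: deq_trans (deq_sym (deq_idr h)) _.
apply: deq_trans (deq_comp (deq_refl _) (deq_sym fg)) _.
apply: deq_trans (deq_assoc _ _ _) _.
apply: deq_trans (deq_comp (X0 _ _) (deq_refl _)) _.
exact: dzero_dcomp.
Qed.

(** Shifts and triangles are handled through functionals, where they are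
  computations on terms; invariance under isomorphism and closure under
  coproducts are formal. *)
Lemma conc_orthogonal_localising (R : comPzRingType) (E : lmodType R) :
  injective_module E -> localising (conc_orthogonal E).
Proof.
move=> injE; split.
- apply/conc_orthogonalP => // n phi _ y _.
  by rewrite (_ : y = 0) ?linear0//; apply/matrixP => ? [].
- exact: conc_orthogonal_iso.
- move=> k X /(conc_orthogonalP _ injE) X0; apply/conc_orthogonalP => //.
  move=> n phi phi0 y /shift_cocycle; apply: X0 => j.
  rewrite -(subrK k j) => w.
  have e : cd X (j - k + k) (n + k) w
           = cd (shift k X) (j - k) n ((-1) ^+ `|k|%N *: w).
    by rewrite /= linearZ /= shift_sign_inj.
  exact: etrans (congr1 phi e) (phi0 _ _).
- move=> X Y Z f g h [A [B [u [a [b [c [[ia ib ic] _]]]]]]] LX LY.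
  apply: (conc_orthogonal_iso (ex_intro _ c ic)); apply/conc_orthogonalP => //.
  have isoA : d_isomorphic A X by exists a.
  have isoB : d_isomorphic B Y by exists b.
  apply: cone_hom_vanishing => //; apply/conc_orthogonalP => //.
    exact: conc_orthogonal_iso (d_isomorphic_sym isoA) LX.
  exact: conc_orthogonal_iso (d_isomorphic_sym isoB) LY.
- move=> I Y C inj coprodC LY i f.
  have [_ uniq] := coprodC _ (fun a => dzero (Y a) (shift i (conc E))).
  by apply: uniq => a; [apply: LY|apply: dzero_dcomp].
Qed.

(** * Baer's criterion and maximal ideals *)

(** A maximal extension [A] of the given partial map is total: the multiples of
  [x] in its domain form an ideal, and a scalar [q] that represents [A] on this
  ideal extends [A] to [x]. *)
Lemma baer_criterion (R : comPzRingType) (E : lmodType R) :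
  (forall G : R^o -> E -> Prop, linear_graph G ->
     exists q, forall r y, G r y -> y = r *: q) ->
  injective_module E.
Proof.
move=> baer M G [linG funG].
have [[x0 [y0 G0]]|noG] := pselect (exists x y, G x y); last first.
  by exists \0 => x y Gxy; case: noG; exists x, y.
pose good (A : set (M * E)) :=
  linear_graph (fun x y => A (x, y)) /\ forall x y, G x y -> A (x, y).
(* Only nonempty sets are required to be good, because the union of the empty
  chain is empty. *)
have [F FP Ftot|A [PA maxA]] :=
    @Zorn_bigcup (M * E)%type (fun A => forall p, A p -> good A).
  move=> p [X FX Xp]; have [[_ _] GX] := FP X FX p Xp; split; last first.
    by move=> x y Gxy; exists X; [|apply: GX].
  split=> [a x y x' y' [Y FY Yxy] [Z FZ Zxy]|y [Y FY Y0]]; last first.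
    by have [[_ +] _] := FP Y FY _ Y0; apply.
  have [YZ|ZY] := Ftot _ _ FY FZ.
    exists Z => //; have [[linZ _] _] := FP Z FZ _ Zxy.
    by apply: linZ => //; apply: YZ.
  exists Y => //; have [[linY _] _] := FP Y FY _ Yxy.
  by apply: linY => //; apply: ZY.
have [p0 Ap0] : exists p, A p.
  apply: contrapT => noA; apply: (maxA (fun p => G p.1 p.2)) => [|p _ //].
  split=> [p Ap|GA]; first by case: noA; exists p.
  by apply: noA; exists (x0, y0); apply: GA.
have [[linA funA] GA] := PA p0 Ap0.
have A0 : A (0, 0).
  case: p0 Ap0 => x y Axy; have := linA (-1) _ _ _ _ Axy Axy.
  by rewrite !scaleN1r !addNr.
have uniqA x y y' : A (x, y) -> A (x, y') -> y' = y.
  move=> Axy Axy'; have := linA (-1) _ _ _ _ Axy Axy'.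
  rewrite !scaleN1r addNr => /funA/eqP.
  by rewrite addrC subr_eq0 => /eqP.
have totA x : exists y, A (x, y).
  have [|q qP] := baer (fun r y => A (r *: x, y)).
    split=> [a r y r' y' Ar Ar'|y].
      by rewrite scalerDl -scalerA; apply: linA.
    by rewrite scale0r => /funA.
  (* The extension of [A] that sends [x] to [q]. *)
  pose B : set (M * E) :=
    fun p => exists r x' y', A (x', y') /\ p = (x' + r *: x, y' + r *: q).
  have AB : (A `<=` B)%classic.
    by move=> [x' y'] Ap; exists 0, x', y'; rewrite !scale0r !addr0.
  exists q; apply: contrapT => nAq; apply: (maxA B) => [|_ _].
    split=> // BA; apply: nAq; apply: BA.
    by exists 1, 0, 0; rewrite !scale1r !add0r.
  split; last by move=> x' y' /GA/AB.
  split=> [a x1 y1 x2 y2 [r1 [u1 [v1 [A1 [-> ->]]]]]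
      [r2 [u2 [v2 [A2 [-> ->]]]]]|y [r [u [v [Auv [e ->]]]]]].
    exists (a * r1 + r2), (a *: u1 + u2), (a *: v1 + v2); split.
      exact: linA.
    by congr pair; rewrite scalerDr scalerA scalerDl addrACA.
  have rxE : r *: x = - u by apply/eqP; rewrite -addr_eq0 addrC -e.
  have /qP <- : A (r *: x, - v).
    by rewrite rxE; have := linA (-1) _ _ _ _ Auv A0; rewrite !addr0 !scaleN1r.
  by rewrite subrr.
have [g gP] := choice totA.
have ling : linear g.
  move=> a x y; have lAg := linA a _ _ _ _ (gP x) (gP y).
  exact: uniqA lAg (gP _).
by exists (mk_linear ling) => x y /GA Axy; apply: uniqA Axy (gP _).
Qed.

Definition maximal_ideal (R : comPzRingType) (m : {pred R^o}) : Prop :=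
  [/\ GRing.submod_closed m, 1 \notin m
    & forall r, r \notin m -> exists s, 1 - s * r \in m].

Lemma ideal_in_maximal (R : comPzRingType) (J : {pred R^o}) :
  GRing.submod_closed J -> 1 \notin J ->
  exists2 m, maximal_ideal m & {subset J <= m}.
Proof.
move=> [J0 linJ] J1.
pose good (A : set R) := [/\ forall a x y, A x -> A y -> A (a * x + y),
  ~ A 1 & forall x, x \in J -> A x].
have [F FP Ftot|A [PA maxA]] :=
    @Zorn_bigcup R (fun A => forall p, A p -> good A).
  move=> p [X FX Xp]; have [_ _ JX] := FP X FX p Xp; split.
  - move=> a x y [Y FY Yx] [Z FZ Zy]; have [YZ|ZY] := Ftot _ _ FY FZ.
      exists Z => //; have [linZ _ _] := FP Z FZ _ Zy.
      by apply: linZ => //; apply: YZ.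
    exists Y => //; have [linY _ _] := FP Y FY _ Yx.
    by apply: linY => //; apply: ZY.
  - by case=> Y FY Y1; have [_ /(_ Y1)] := FP Y FY _ Y1.
  - by move=> x Jx; exists X => //; apply: JX.
have [p0 Ap0] : exists p, A p.
  apply: contrapT => noA; apply: (maxA (fun p => p \in J)) => [|p _].
    split=> [p Ap|JA]; first by case: noA; exists p.
    by apply: noA; exists 0; apply: JA.
  by split=> [a x y Jx Jy||//]; [apply: (linJ a)|apply/negP].
have [linA A1 JA] := PA p0 Ap0.
have A0 : A 0 by rewrite -(addNr p0) -mulN1r; apply: linA.
exists (fun x => `[<A x>]); last by move=> x Jx; apply/asboolP/JA.
split.
- split; first exact/asboolP.
  by move=> a x y /asboolP Ax /asboolP Ay; apply/asboolP/(linA a).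
- by apply/asboolP.
move=> r /asboolP nAr.
pose B : set R := fun x => exists s a, A a /\ x = a + s * r.
have AB : (A `<=` B)%classic by move=> a Aa; exists 0, a; rewrite mul0r addr0.
have [B1|nB1] := pselect (B 1).
  by case: B1 => s [a [Aa e]]; exists s; apply/asboolP; rewrite e addrK.
case: (maxA B) => [|_ _].
  split=> // BA; apply/nAr/BA.
  by exists 1, 0; rewrite mul1r add0r.
split=> // [a x y [s [u [Au ->]]] [t [v [Av ->]]]|x /JA/AB//].
exists (a * s + t), (a * u + v); split; first exact: linA.
by rewrite mulrDr mulrDl mulrA addrACA.
Qed.

(** A nonzero element [z] that [m] annihilates spans a copy of the field [R/m],
  which is simple. *)
Lemma maximal_torsion_free (R : comPzRingType) (M : lmodType R)
    (m : {pred R^o}) (z : M) :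
  (forall S : {pred M}, ~ simple_submod S) -> maximal_ideal m ->
  (forall r, r \in m -> r *: z = 0) -> z = 0.
Proof.
move=> noS [_ _ maxm] mz; apply: contrapT => /eqP z0.
apply: (noS (fun x => `[<exists r, x = r *: z>])); split.
- split; first by apply/asboolP; exists 0; rewrite scale0r.
  move=> a x y /asboolP[r ->] /asboolP[s ->]; apply/asboolP.
  by exists (a * r + s); rewrite scalerDl scalerA.
- by exists z => //; apply/asboolP; exists 1; rewrite scale1r.
move=> T [T0 linT] TS.
have [[x Tx /eqP x0]|noT] := pselect (exists2 x, x \in T & x <> 0); last first.
  by left=> x Tx; apply: contrapT => x0; apply: noT; exists x.
right=> y /asboolP[t ->]; have /asboolP[r e] := TS x Tx.
have rm : r \notin m by apply: contraNN x0 => rm; rewrite e mz.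
have [s /mz] := maxm r rm.
rewrite scalerBl scale1r -scalerA => /eqP; rewrite subr_eq0 -e => /eqP ->.
by rewrite scalerA -[_ *: _]addr0; apply: linT.
Qed.

(** * Quotient modules *)

(** Representatives of the elements of a module: the module axioms hold only up
  to the equivalence [pm_eq]. Both quotients by submodules and modules of
  quotients arise in this way. *)
Record premodule (R : comPzRingType) := Premodule {
  pm_sort : Type;
  pm_eq : pm_sort -> pm_sort -> Prop;
  pm_zero : pm_sort;
  pm_add : pm_sort -> pm_sort -> pm_sort;
  pm_scale : R -> pm_sort -> pm_sort;
  pm_refl : forall x, pm_eq x x;
  pm_sym : forall x y, pm_eq x y -> pm_eq y x;
  pm_trans : forall x y z, pm_eq x y -> pm_eq y z -> pm_eq x z;
  pm_add_eq : forall x x' y y',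
    pm_eq x x' -> pm_eq y y' -> pm_eq (pm_add x y) (pm_add x' y');
  pm_scale_eq : forall a x x',
    pm_eq x x' -> pm_eq (pm_scale a x) (pm_scale a x');
  pm_addA : forall x y z,
    pm_eq (pm_add x (pm_add y z)) (pm_add (pm_add x y) z);
  pm_addC : forall x y, pm_eq (pm_add x y) (pm_add y x);
  pm_add0 : forall x, pm_eq (pm_add pm_zero x) x;
  pm_addN : forall x, pm_eq (pm_add (pm_scale (-1) x) x) pm_zero;
  pm_scaleA : forall a b x,
    pm_eq (pm_scale a (pm_scale b x)) (pm_scale (a * b) x);
  pm_scale1 : forall x, pm_eq (pm_scale 1 x) x;
  pm_scaleDr : forall a x y,
    pm_eq (pm_scale a (pm_add x y)) (pm_add (pm_scale a x) (pm_scale a y));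
  pm_scaleDl : forall a b x,
    pm_eq (pm_scale (a + b) x) (pm_add (pm_scale a x) (pm_scale b x))
}.

Section PremoduleQuotient.
Variables (R : comPzRingType) (P : premodule R).

Let T : Type := {classic pm_sort P}.
HB.instance Definition _ := Choice.on T.

Definition pm_eqb (x y : T) : bool := `[< @pm_eq R P x y >].

Lemma pm_eqb_equiv : equiv_class_of pm_eqb.
Proof.
split=> [x|x y|y x z]; first exact/asboolP/pm_refl.
- by apply/asboolP/asboolP; apply: pm_sym.
- by move=> /asboolP xy /asboolP yz; apply/asboolP/(pm_trans xy).
Qed.

Canonical pm_eqb_rel := EquivRelPack pm_eqb_equiv.

Definition pm_quot : Type := {eq_quot pm_eqb_rel}%qT.
HB.instance Definition _ := Choice.on pm_quot.
HB.instance Definition _ := EqQuotient.on pm_quot.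

Definition pm_pi (x : pm_sort P) : pm_quot := (\pi_pm_quot (x : T))%qT.
Definition pm_repr (q : pm_quot) : pm_sort P := (repr q : T).

Lemma pm_piP x y : pm_pi x = pm_pi y <-> pm_eq x y.
Proof. by split=> [/eqmodP/asboolP|xy]; last exact/eqmodP/asboolP. Qed.

Lemma pm_reprK : cancel pm_repr pm_pi.
Proof. by move=> q; apply: reprK. Qed.

Lemma pm_repr_pi x : pm_eq (pm_repr (pm_pi x)) x.
Proof. by apply/pm_piP; rewrite pm_reprK. Qed.

Definition pmq_add (s t : pm_quot) : pm_quot :=
  pm_pi (pm_add (pm_repr s) (pm_repr t)).
Definition pmq_scale a (s : pm_quot) : pm_quot :=
  pm_pi (pm_scale a (pm_repr s)).

Lemma pmq_addE x y : pmq_add (pm_pi x) (pm_pi y) = pm_pi (pm_add x y).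
Proof. by apply/pm_piP/pm_add_eq; apply: pm_repr_pi. Qed.

Lemma pmq_scaleE a x : pmq_scale a (pm_pi x) = pm_pi (pm_scale a x).
Proof. by apply/pm_piP/pm_scale_eq/pm_repr_pi. Qed.

Lemma pmq_addA : associative pmq_add.
Proof.
move=> r s t; rewrite -(pm_reprK r) -(pm_reprK s) -(pm_reprK t) !pmq_addE.
exact/pm_piP/pm_addA.
Qed.

Lemma pmq_addC : commutative pmq_add.
Proof.
move=> s t; rewrite -(pm_reprK s) -(pm_reprK t) !pmq_addE.
exact/pm_piP/pm_addC.
Qed.

Lemma pmq_add0 : left_id (pm_pi (pm_zero P)) pmq_add.
Proof. by move=> s; rewrite -(pm_reprK s) pmq_addE; apply/pm_piP/pm_add0. Qed.

Lemma pmq_addN : left_inverse (pm_pi (pm_zero P)) (pmq_scale (-1)) pmq_add.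
Proof.
move=> s; rewrite -(pm_reprK s) pmq_scaleE pmq_addE.
exact/pm_piP/pm_addN.
Qed.

HB.instance Definition _ :=
  GRing.isZmodule.Build pm_quot pmq_addA pmq_addC pmq_add0 pmq_addN.

Lemma pmq_scaleA a b s : pmq_scale a (pmq_scale b s) = pmq_scale (a * b) s.
Proof. by rewrite -(pm_reprK s) !pmq_scaleE; apply/pm_piP/pm_scaleA. Qed.

Lemma pmq_scale1 : left_id 1 pmq_scale.
Proof.
by move=> s; rewrite -(pm_reprK s) pmq_scaleE; apply/pm_piP/pm_scale1.
Qed.

Lemma pmq_scaleDr : right_distributive pmq_scale +%R.
Proof.
move=> a s t; rewrite -(pm_reprK s) -(pm_reprK t) /+%R/=.
rewrite !(pmq_addE, pmq_scaleE).
exact/pm_piP/pm_scaleDr.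
Qed.

Lemma pmq_scaleDl s : {morph pmq_scale^~ s : a b / a + b}.
Proof.
move=> a b; rewrite -(pm_reprK s) /= /+%R/= !pmq_scaleE [RHS]pmq_addE.
exact/pm_piP/pm_scaleDl.
Qed.

HB.instance Definition _ :=
  GRing.Zmodule_isLmodule.Build R pm_quot
    pmq_scaleA pmq_scale1 pmq_scaleDr pmq_scaleDl.

Lemma pm_piD x y : pm_pi (pm_add x y) = pm_pi x + pm_pi y.
Proof. by rewrite -pmq_addE. Qed.

Lemma pm_piZ a x : pm_pi (pm_scale a x) = a *: pm_pi x.
Proof. by rewrite -pmq_scaleE. Qed.

End PremoduleQuotient.

Section QuotientModule.
Variables (R : comPzRingType) (M : lmodType R) (N : {pred M}).
Hypothesis subN : GRing.submod_closed N.

Let N0 : 0 \in N. Proof. by case: subN. Qed.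
Let NP a x y : x \in N -> y \in N -> a *: x + y \in N.
Proof. by case: subN => _; apply. Qed.
Let NZ a x : x \in N -> a *: x \in N.
Proof. by move=> Nx; rewrite -[_ *: _]addr0 NP. Qed.
Let ND x y : x \in N -> y \in N -> x + y \in N.
Proof. by move=> Nx Ny; rewrite -[x]scale1r NP. Qed.

Let eqN (x y : M) : x = y -> x - y \in N.
Proof. by move=> ->; rewrite subrr. Qed.

Definition quot_premodule : premodule R.
Proof.
apply: (@Premodule R M (fun x y => x - y \in N) 0 +%R *:%R) => /=.
- by move=> x; apply: eqN.
- by move=> x y /(NZ (-1)); rewrite scaleN1r opprB.
- by move=> x y z xy /(ND xy); rewrite addrA subrK.
- by move=> x x' y y' xx' /(ND xx'); rewrite opprD addrACA.
- by move=> a x x' /(NZ a); rewrite scalerBr.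
- by move=> x y z; apply/eqN/addrA.
- by move=> x y; apply/eqN/addrC.
- by move=> x; apply/eqN/add0r.
- by move=> x; apply/eqN; rewrite scaleN1r addNr.
- by move=> a b x; apply/eqN/scalerA.
- by move=> x; apply/eqN/scale1r.
- by move=> a x y; apply/eqN/scalerDr.
- by move=> a b x; apply/eqN/scalerDl.
Defined.

Definition quot_mod : lmodType R := pm_quot quot_premodule.

Definition quot_pi (x : M) : quot_mod := @pm_pi R quot_premodule x.

Lemma quot_pi_linear : linear quot_pi.
Proof. by move=> a x y; rewrite /quot_pi -pm_piZ -pm_piD. Qed.

HB.instance Definition _ :=
  GRing.isLinear.Build R M quot_mod _ quot_pi quot_pi_linear.

Definition quot_repr (q : quot_mod) : M := @pm_repr R quot_premodule q.

Lemma quot_reprK : cancel quot_repr quot_pi.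
Proof. exact: pm_reprK. Qed.

Lemma quot_pi_eq0 x : quot_pi x = 0 <-> x \in N.
Proof.
rewrite -(linear0 quot_pi) /quot_pi; split=> [/pm_piP|Nx].
  by rewrite /= subr0.
by apply/pm_piP; rewrite /= subr0.
Qed.

End QuotientModule.

(** * The module of quotients *)

Section ModuleOfQuotients.
Variables (R : comPzRingType) (M : lmodType R).

Definition dense (D : R -> Prop) : Prop :=
  forall z : M, (forall d, D d -> d *: z = 0) -> z = 0.

Record partial_hom := PartialHom {
  ph_dom : R -> Prop;
  ph_fun :> R -> M;
  ph_linear : forall a x y, ph_dom x -> ph_dom y ->
    ph_dom (a * x + y) /\ ph_fun (a * x + y) = a *: ph_fun x + ph_fun y;
  ph_dense : dense ph_dom
}.

Implicit Types p q : partial_hom.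

Lemma ph_scale p a x :
  ph_dom p x -> ph_dom p (a * x) /\ p (a * x) = a *: p x.
Proof.
move=> px; have [] := ph_linear (a - 1) px px.
rewrite -[x in _ * x + x]mul1r mulrA mulr1 -mulrDl subrK => paE ->.
by rewrite scalerBl scale1r subrK.
Qed.

Definition ph_eq p q : Prop :=
  forall x, ph_dom p x -> ph_dom q x -> p x = q x.

(** On the intersection of the domains of [p] and [r], the difference of [p] and
  [r] is annihilated by the domain of [q], which is dense. *)
Lemma ph_eq_trans p q r : ph_eq p q -> ph_eq q r -> ph_eq p r.
Proof.
move=> pq qr x px rx; apply/eqP; rewrite -subr_eq0; apply/eqP.
apply: (ph_dense (p := q)) => d qd.
have [pdx pdE] := ph_scale d px; have [rdx rdE] := ph_scale d rx.
have [qdx _] := ph_scale x qd; rewrite mulrC in qdx.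
by rewrite scalerBr -pdE -rdE pq// qr// subrr.
Qed.

Definition ph_zero : partial_hom.
Proof.
apply: (@PartialHom (fun=> True) (fun=> 0)) => [a x y _ _|z /(_ 1 I)].
  by rewrite scaler0 addr0.
by rewrite scale1r.
Defined.

Definition ph_add p q : partial_hom.
Proof.
apply: (@PartialHom (fun x => ph_dom p x /\ ph_dom q x) (fun x => p x + q x)).
  move=> a x y [px qx] [py qy].
  have [pxy ->] := ph_linear a px py; have [qxy ->] := ph_linear a qx qy.
  by rewrite scalerDr addrACA.
move=> z pqz; apply: (ph_dense (p := p)) => d pd.
apply: (ph_dense (p := q)) => e qe; rewrite scalerA.
apply: pqz; split; first exact: (ph_scale _ pd).1.
by rewrite mulrC; apply: (ph_scale _ qe).1.
Defined.

Definition ph_mul (a : R) p : partial_hom.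
Proof.
apply: (@PartialHom (ph_dom p) (fun x => a *: p x)) => [b x y px py|].
  have [pxy ->] := ph_linear b px py.
  by rewrite scalerDr !scalerA [b * a]mulrC.
exact: ph_dense.
Defined.

Definition quotients_premodule : premodule R.
Proof.
apply: (@Premodule R partial_hom ph_eq ph_zero ph_add ph_mul).
- by [].
- by move=> p q pq x qx px; rewrite pq.
- exact: ph_eq_trans.
- by move=> p p' q q' pp qq x [px qx] [p'x q'x] /=; rewrite pp// qq.
- by move=> a p p' pp x px p'x /=; rewrite pp.
- by move=> p q r x _ _ /=; rewrite addrA.
- by move=> p q x _ _ /=; rewrite addrC.
- by move=> p x _ _ /=; rewrite add0r.
- by move=> p x _ _ /=; rewrite scaleN1r addNr.
- by move=> a b p x _ _ /=; rewrite scalerA.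
- by move=> p x _ _ /=; rewrite scale1r.
- by move=> a p q x _ _ /=; rewrite scalerDr.
- by move=> a b p x _ _ /=; rewrite scalerDl.
Defined.

Definition quotients : lmodType R := pm_quot quotients_premodule.
Definition class_of p : quotients := @pm_pi R quotients_premodule p.

Lemma class_ofP p q : class_of p = class_of q <-> ph_eq p q.
Proof. exact: (@pm_piP R quotients_premodule). Qed.

Lemma class_of_surj (s : quotients) : exists p, s = class_of p.
Proof. by exists (pm_repr s); rewrite /class_of pm_reprK. Qed.

Lemma class_ofZ a p : a *: class_of p = class_of (ph_mul a p).
Proof. by rewrite /class_of -pm_piZ. Qed.

Lemma class_of0 p : (forall x, ph_dom p x -> p x = 0) -> class_of p = 0.
Proof.
move=> p0; rewrite -[0]/(class_of ph_zero).
by apply/class_ofP => x px _; rewrite p0.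
Qed.

Definition ph_const (z : M) : partial_hom.
Proof.
apply: (@PartialHom (fun=> True) (fun r => r *: z)) => [a x y _ _|w /(_ 1 I)].
  by rewrite scalerDl scalerA.
by rewrite scale1r.
Defined.

Definition embed (z : M) : quotients := class_of (ph_const z).

Lemma embed_linear : linear embed.
Proof.
move=> a x y; rewrite /embed /class_of -pm_piZ -pm_piD.
apply/pm_piP => r _ _ /=.
by rewrite scalerDr !scalerA [r * a]mulrC.
Qed.

HB.instance Definition _ :=
  GRing.isLinear.Build R M quotients _ embed embed_linear.

Lemma embed_eq0 z : embed z = 0 -> z = 0.
Proof.
by rewrite -[0]/(class_of ph_zero) => /class_ofP/(_ 1 I I) /=; rewrite scale1r.
Qed.

Lemma scale_class_of p d : ph_dom p d -> d *: class_of p = embed (p d).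
Proof.
move=> pd; rewrite class_ofZ; apply/class_ofP => x.
rewrite [ph_dom _ x]/= => px _ /=.
by rewrite -(ph_scale x pd).2 -(ph_scale d px).2 mulrC.
Qed.

(** For the maximal ideals, which are dense when [M] has no simple submodule,
  this says that [quotients M] has none either. *)
Lemma quotients_separated (D : R -> Prop) (s : quotients) :
  dense D -> (forall d, D d -> d *: s = 0) -> s = 0.
Proof.
move=> denseD; have [p ->] := class_of_surj s => p0.
apply: class_of0 => x px; apply: denseD => d Dd.
apply: embed_eq0; rewrite linearZ/= -scale_class_of// scalerA mulrC -scalerA.
by rewrite p0// scaler0.
Qed.

(** By Baer's criterion, let [G] be a partial map from [R] to [quotients M]. The
  elements that it sends into [M] form an ideal, and [K] is the ideal of those
  [k] with [k s M = 0] for each [s] in it. Since [R] is absolutely flat, the sum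
  of the two ideals is dense, and [G] vanishes on their intersection. So the map
  equal to [G] on the first and to zero on [K] is well defined; its class
  represents [G], because both agree after multiplication by a dense ideal. *)
Lemma quotients_injective (g : M) :
  absolutely_flat R -> (forall z : M, exists a, z = a *: g) ->
  injective_module quotients.
Proof.
move=> flatR gen; apply: baer_criterion => G [linG funG].
have [[r0 [y0 Gr0]]|noG] := pselect (exists r y, G r y); last first.
  by exists 0 => r y Gry; case: noG; exists r, y.
have G00 : G 0 0.
  by have := linG (-1) _ _ _ _ Gr0 Gr0; rewrite !scaleN1r !addNr.
have GZ a r y : G r y -> G (a *: r) (a *: y).
  by move=> Gry; have := linG a _ _ _ _ Gry G00; rewrite !addr0.
have sq_kill (r : R) (z : M) : (r * r) *: z = 0 -> r *: z = 0.
  move=> rrz; have [x {1}->] := flatR r.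
  by rewrite expr2 mulrC -scalerA rrz scaler0.
pose K (k : R) := forall s z, G s (embed z) -> (k * s) *: g = 0.
(* The graph of the map equal to [G] on the first ideal and to zero on [K]. *)
pose H (x : R) (z : M) := exists r k, [/\ G r (embed z), K k & x = r + k].
have K0 : K 0 by move=> s z _; rewrite mul0r scale0r.
have linH a x y z w : H x z -> H y w -> H (a * x + y) (a *: z + w).
  move=> [r [k [Gr Kk ->]]] [s [l [Gs Kl ->]]].
  exists (a * r + s), (a * k + l); split.
  - by rewrite linearP; apply: linG.
  - move=> t v Gt; rewrite mulrDl -mulrA scalerDl -scalerA (Kk _ _ Gt).
    by rewrite (Kl _ _ Gt) scaler0 addr0.
  - by rewrite mulrDr addrACA.
have funH0 z : H 0 z -> z = 0.
  case=> r [k [Gr Kk /esym/eqP]]; rewrite addr_eq0 => /eqP e.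
  have rg : r *: g = 0.
    by apply: sq_kill; rewrite {1}e mulNr scaleNr (Kk _ _ Gr) oppr0.
  have rq (s : quotients) : r *: s = 0.
    have [p ->] := class_of_surj s; rewrite class_ofZ.
    apply: class_of0 => x px /=; have [a ->] := gen (p x).
    by rewrite scalerA mulrC -scalerA rg scaler0.
  have [x rE] := flatR r.
  have Gr' : G r 0.
    have := GZ (x * r) _ _ Gr; rewrite -[_ *: embed z]scalerA rq scaler0.
    by rewrite /*:%R/= -mulrA mulrC -expr2 -rE.
  have := linG (-1) _ _ _ _ Gr' Gr.
  by rewrite !scaleN1r addNr oppr0 add0r => /funG/embed_eq0.
have funH x z w : H x z -> H x w -> w = z.
  move=> Hz Hw; have := linH (-1) _ _ _ _ Hz Hw.
  rewrite mulN1r addNr scaleN1r => /funH0/eqP.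
  by rewrite addrC subr_eq0 => /eqP.
have [h hP] : exists h : R -> M, forall x z, H x z -> h x = z.
  have [x|h hH] := choice (P := fun x z => forall w, H x w -> H x z).
    have [[z Hz]|noz] := pselect (exists z, H x z); first by exists z.
    by exists 0 => w Hw; case: noz; exists w.
  by exists h => x z Hz; apply: funH Hz (hH x z Hz).
have GH r z : G r (embed z) -> H r z.
  by move=> Gr; exists r, 0; rewrite addr0.
pose D x := exists z, H x z.
have linD a x y : D x -> D y -> D (a * x + y) /\ h (a * x + y) = a *: h x + h y.
  move=> [z Hz] [w Hw]; have Hzw := linH a _ _ _ _ Hz Hw.
  rewrite (hP _ _ Hz) (hP _ _ Hw) (hP _ _ Hzw).
  by split=> //; exists (a *: z + w).
have denseD : dense D.
  move=> z Dz; have [a e] := gen z; rewrite e; apply: sq_kill.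
  rewrite -scalerA -e; apply: (Dz); exists 0; exists 0, a.
  split; [by rewrite linear0| |by rewrite add0r] => s w Gs.
  by rewrite mulrC -scalerA -e; apply: Dz; exists w; apply: GH.
exists (class_of (PartialHom linD denseD)) => r y Gry.
have [p yE] := class_of_surj y.
apply/eqP; rewrite -subr_eq0; apply/eqP.
apply: (quotients_separated (ph_dense (p := p))) => d pd.
have Hdr : H (d * r) (p d).
  by apply: GH; rewrite -scale_class_of// -yE; apply: GZ.
rewrite scalerBr scalerA scale_class_of; last by exists (p d).
by rewrite /= (hP _ _ Hdr) yE scale_class_of// subrr.
Qed.

End ModuleOfQuotients.

(** * Tensor products with quotients of the ring *)

Section IdealMultiples.
Variables (R : comPzRingType) (M : lmodType R) (J : {pred R^o}).
Hypothesis subJ : GRing.submod_closed J.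

(** The submodule [J M]. Over an absolutely flat ring, finitely many elements of
  [J] are all multiples of one idempotent of [J], so each element of [J M] is
  fixed by some [e] in [J]. *)
Definition ideal_multiples : {pred M} :=
  fun z => `[<exists2 e : R, e \in J & z = e *: z>].

Lemma ideal_multiples_closed : GRing.submod_closed ideal_multiples.
Proof.
have [J0 linJ] := subJ.
split=> [|a x y /asboolP[e eJ xE] /asboolP[f fJ yE]]; apply/asboolP.
  by exists 0 => //; rewrite scale0r.
(* [1 - (1 - f) (1 - e)], which fixes both [x] and [y]. *)
exists ((1 - f) * e + f); first exact: (linJ (1 - f)).
have gx : ((1 - f) * e + f) *: x = x.
  by rewrite scalerDl -scalerA -xE scalerBl scale1r subrK.
have gy : ((1 - f) * e + f) *: y = y.
  rewrite scalerDl mulrC -scalerA scalerBl scale1r -yE subrr scaler0.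
  by rewrite add0r.
by rewrite scalerDr gy scalerA mulrC -scalerA gx.
Qed.

End IdealMultiples.

Lemma ctrans0 (R : comPzRingType) (X : int -> lmodType R) i j (x : X i) :
  i != j -> ctrans X i j x = 0.
Proof. by rewrite /ctrans; case: eqP. Qed.

Section TensorZero.
Variables (R : comPzRingType) (X Y : complex R) (n i j : int).

Lemma tens0l (y : Y j) : tens n (0 : X i) y = 0.
Proof.
have := bf_linl (tens_bilinear X Y n) (i := i) y (-1) 0 0.
by rewrite scaler0 addr0 scaleN1r addNr.
Qed.

Lemma tens0r (x : X i) : tens n x (0 : Y j) = 0.
Proof.
have := bf_linr (tens_bilinear X Y n) (j := j) x (-1) 0 0.
by rewrite scaler0 addr0 scaleN1r addNr.
Qed.
End TensorZero.

Section TensorQuotient.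
Variables (R : comPzRingType) (J : {pred R^o}).
Hypothesis subJ : GRing.submod_closed J.

Let k := quot_mod subJ.
Let Y := conc k.

Definition conc_unit : Y 0 := @conc_in R k (0 == 0) (quot_pi subJ 1).

Lemma scale_conc_unit (r : R^o) :
  r *: conc_unit = @conc_in R k (0 == 0) (quot_pi subJ r).
Proof.
have -> : quot_pi subJ r = r *: quot_pi subJ 1.
  by rewrite -linearZ /=; congr (quot_pi _ _); rewrite [RHS]mulr1.
by rewrite [RHS]linearZ.
Qed.

Lemma conc_unit_gen (y : Y 0) : exists r, y = r *: conc_unit.
Proof.
exists (quot_repr (conc_out y)); rewrite scale_conc_unit quot_reprK.
exact: (esym (conc_outK _)).
Qed.

Lemma conc_unit_eq0 r : r *: conc_unit = 0 <-> r \in J.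
Proof. by rewrite scale_conc_unit; apply: (quot_pi_eq0 subJ). Qed.

Lemma conc_off0 j (y : Y j) : j != 0 -> y = 0.
Proof.
by move=> j0; rewrite -(conc_outK y) conc_out0// linear0.
Qed.

Variable X : complex R.

Lemma tens_conc n (t : tens_obj X Y n) :
  exists w : X n, t = tens n w conc_unit.
Proof.
have tb := tens_bilinear X Y n.
rewrite (tens_sum t); elim/big_ind: _ => [|s s' [w ->] [w' ->]|g _].
- by exists 0; rewrite tens0l.
- exists (w + w'); have := bf_linl tb conc_unit 1 w w'.
  by rewrite !scale1r.
case: g => -[i j] [x y] /=.
have [e|j0] := eqVneq j 0; last first.
  by exists 0; rewrite (conc_off0 y j0) tens0r tens0l.
subst j; have [e|ne] := eqVneq i n; last first.
  by exists 0; rewrite (bf_deg tb) ?tens0l// addr0.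
subst i; have [r ->] := conc_unit_gen y.
exists (r *: x); have := bf_linl tb conc_unit r x 0.
have := bf_linr tb x r conc_unit 0.
by rewrite tens0l tens0r !addr0 => -> ->.
Qed.

(** The evaluation [x (x) r |-> r x] identifies the tensor product with the
  quotient of [X n] by [J (X n)]. *)
Lemma tens_conc_eq0 n (w : X n) :
  absolutely_flat R -> tens n w conc_unit = 0 ->
  exists2 e, e \in J & w = e *: w.
Proof.
move=> flatR w0; pose subN := ideal_multiples_closed (X n) subJ.
have Jpi e v : e \in J -> e *: quot_pi subN v = 0.
  move=> eJ; rewrite -linearZ; apply/quot_pi_eq0/asboolP.
  have [x eE] := flatR e.
  exists (x * e).
    by have [J0 linJ] := subJ; rewrite -[_ * _]addr0; apply: (linJ x).
  by rewrite scalerA -mulrA mulrC -expr2 -eE.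
have reprE (q : k) (r : R^o) (v : X n) :
    quot_pi subJ r = q -> quot_repr q *: quot_pi subN v = r *: quot_pi subN v.
  move=> qE; apply/eqP; rewrite -subr_eq0 -scalerBl; apply/eqP/Jpi.
  by apply/(quot_pi_eq0 subJ); rewrite linearB /= quot_reprK qE subrr.
pose b i j (x : X i) (y : Y j) : quot_mod subN :=
  quot_repr (conc_out y) *: quot_pi subN (ctrans X i n x).
have hb : bilinear_family n b.
  split=> [i j y a x x'|i j x a y y'|i j x y ij]; rewrite /b.
  - by rewrite linearP /= linearP /= scalerDr !scalerA mulrC.
  - rewrite scalerA -scalerDl; apply: reprE.
    rewrite linearD linearZ/= !quot_reprK.
    exact/esym/(@conc_out_linear R k (j == 0)).
  - have [e|j0] : j = 0 \/ j != 0 by case: eqVneq; [left|right].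
      by rewrite e addr0 in ij; rewrite ctrans0// linear0.
    rewrite (conc_off0 y j0) (reprE _ 0) ?scale0r//.
    by rewrite [LHS]linear0 [RHS]linear0.
have := congr1 (tens_lift hb) w0; rewrite linear0 tens_liftE /b ctrans_id.
rewrite (reprE _ 1) ?scale1r; last by rewrite conc_inK.
by move=> /quot_pi_eq0/asboolP.
Qed.

Lemma tens_d_conc n m i (x : X i) : n + 1 = m ->
  tens_d X Y n m (tens n x conc_unit) = tens m (cd X i (i + 1) x) conc_unit.
Proof.
move=> nm; rewrite tens_liftE /tens_d_family nm eqxx conc_cd.
by rewrite tens0r scaler0 addr0.
Qed.

(** The cocycle [x (x) 1] is the coboundary of some [v (x) 1], so [x] and [d v]
  agree modulo [J X]. *)
Lemma coboundary_mod_ideal n (x : X (n + 1)) :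
  absolutely_flat R -> acyclic (tensor X Y) -> cocycle x ->
  exists (v : X n) (e : R), e \in J /\
    x - cd X n (n + 1) v = e *: (x - cd X n (n + 1) v).
Proof.
move=> flatR ac cx.
have tb := bf_linl (tens_bilinear X Y (n + 1)) conc_unit.
have cx1 : @cocycle R (tensor X Y) _ (tens (n + 1) x conc_unit).
  apply: cocycle_next; rewrite [LHS]tens_d_conc// cx.
  exact: tens0l.
have /(coboundaryP erefl)[t] := ac _ _ cx1.
have [v ->] := tens_conc t; rewrite [LHS]tens_d_conc// => e.
have : tens (n + 1) (x - cd X n (n + 1) v) conc_unit = 0.
  by rewrite [x - _]addrC -scaleN1r tb e scaleN1r addNr.
by move=> /(tens_conc_eq0 flatR)[a Ja xE]; exists v, a.
Qed.

(** For [J = 0] the tensor product is [X] itself. *)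
Lemma acyclic_tensor n (x : tensor X Y n) :
  absolutely_flat R -> (forall r, r \in J -> r = 0) -> acyclic X ->
  cocycle x -> coboundary x.
Proof.
move=> flatR JE ac; have [w ->] := tens_conc x => /(_ (n + 1)).
rewrite [LHS]tens_d_conc// => /(tens_conc_eq0 flatR)[e /JE->].
rewrite scale0r => /cocycle_next/ac/(coboundaryP (subrK 1 n))[v <-].
exists (n - 1), (tens (n - 1) v conc_unit).
by rewrite [LHS]tens_d_conc ?subrK.
Qed.

End TensorQuotient.

(** * Residue fields and Bousfield classes *)

(** A functional is determined by the image of [1], which [m] annihilates. *)
Lemma residue_field_orthogonal (R : comPzRingType) (M : lmodType R)
    (m : {pred R^o}) (subm : GRing.submod_closed m) :
  (forall S : {pred M}, ~ simple_submod S) ->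
  injective_module (quotients M) -> maximal_ideal m ->
  conc_orthogonal (quotients M) (conc (quot_mod subm)).
Proof.
move=> noS injE maxm; apply/conc_orthogonalP => // n phi _ y _.
have [e|n0] := eqVneq n 0; last by rewrite (conc_off0 y n0) linear0.
subst n; have [r ->] := conc_unit_gen y; rewrite linearZ /=.
rewrite [phi _](_ : _ = 0) ?scaler0//.
apply: (@quotients_separated R M (fun r => r \in m)).
  by move=> z; apply: maximal_torsion_free.
by move=> s sm; rewrite -linearZ /= (conc_unit_eq0 subm s).2// linear0.
Qed.

(** Each element [z] of [M] is the image of [1] under a map from [R] to
  [quotients M], and this map is zero in the derived category only if [z] is.
  The ring appears as its quotient by the zero ideal [J], so that tensor products
  with it and with residue fields have one description. *)
Lemma regular_module_not_orthogonal (R : comPzRingType) (M : lmodType R)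
    (J : {pred R^o}) (subJ : GRing.submod_closed J) (z : M) :
  (forall r, r \in J -> r = 0) -> injective_module (quotients M) ->
  conc_orthogonal (quotients M) (conc (quot_mod subJ)) -> z = 0.
Proof.
move=> JE injE /(conc_orthogonalP _ injE) LR.
have [|phi phiP] := injE _ (fun w e => exists r,
    w = r *: conc_unit subJ /\ e = r *: embed z).
  split=> [a _ _ _ _ [r [-> ->]] [s [-> ->]]|e [r [/esym r0 ->]]].
    by exists (a * r + s); rewrite !scalerDl !scalerA.
  by move: r0 => /(conc_unit_eq0 subJ)/JE ->; rewrite scale0r.
have cu : cocycle (conc_unit subJ) by [].
have := LR 0 phi (fun j w => linear0 phi) _ cu.
rewrite (phiP _ (embed z)); last by exists 1; rewrite !scale1r.
exact: embed_eq0.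
Qed.

(** Let [m] be a maximal ideal containing the annihilator of the class of a
  cocycle [x] that is not a coboundary. Modulo [m X], [x] is a coboundary [d v],
  so [(1 - e) (x - d v)] vanishes for some [e] in [m]; then [1 - e] annihilates
  the class of [x] and lies in [m], which is absurd. *)
Lemma residue_fields_detect_acyclic (R : comPzRingType) (X : complex R) :
  absolutely_flat R ->
  (forall (m : {pred R^o}) (subm : GRing.submod_closed m), maximal_ideal m ->
     acyclic (tensor X (conc (quot_mod subm)))) ->
  acyclic X.
Proof.
move=> flatR acm j; rewrite -(subrK 1 j); move: (j - 1) => n x cx.
apply: contrapT => nbx.
pose J : {pred R^o} := fun r => `[<coboundary (r *: x)>].
have subJ : GRing.submod_closed J.
  split; first by apply/asboolP; rewrite scale0r; apply: coboundary0.
  move=> a r s /asboolP br /asboolP bs; apply/asboolP.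
  by rewrite scalerDl -scalerA; apply/coboundaryD/bs/coboundaryZ.
have J1 : 1 \notin J by apply/asboolP; rewrite scale1r.
have [m maxm Jm] := ideal_in_maximal subJ J1.
have [subm m1 _] := maxm.
have [v [e [em xv]]] := coboundary_mod_ideal flatR (acm m subm maxm) cx.
have : 1 - e \in J.
  apply/asboolP; exists n, ((1 - e) *: v); rewrite linearZ /=.
  apply/eqP; rewrite eq_sym -subr_eq0 -scalerBr scalerBl scale1r -xv.
  by rewrite subrr.
move=> /Jm e1; have [m0 linm] := subm; move/negP: m1; apply.
by have := linm 1 _ _ em e1; rewrite scale1r addrC subrK.
Qed.

Theorem corollary4p11 (R : comPzRingType) :
  absolutely_flat R -> ~ noetherian R -> ~ semi_artinian R ->
  exists L : complex R -> Prop,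
    [/\ localising L, cohomological_bousfield_class L & ~ bousfield_class L].
Proof.
move=> flatR _ nsa.
have [M [f [fsurj [y0 ny0] noS]]] :
    exists (M : lmodType R) (f : {linear R^o -> M}),
    [/\ forall y, exists x, f x = y, exists y : M, y != 0
       & forall S : {pred M}, ~ simple_submod S].
  apply: contrapT => noM; apply: nsa => M f fsurj ny.
  apply: contrapT => noS; apply: noM; exists M, f; split=> // S sS.
  by apply: noS; exists S.
have gen z : exists a, z = a *: f 1.
  have [a <-] := fsurj z; exists a; rewrite -linearZ /=.
  by congr (f _); rewrite [RHS]mulr1.
have injE := quotients_injective flatR gen.
exists (conc_orthogonal (quotients M)); split.
- exact: conc_orthogonal_localising.
- by exists (conc (quotients M)).
case=> X LX.
have acX : acyclic X.
  apply: residue_fields_detect_acyclic => // m subm maxm.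
  exact/d_isomorphic_zeroP/LX/residue_field_orthogonal.
pose Z : {pred R^o} := fun r => r == 0.
have subZ : GRing.submod_closed Z.
  split; first exact: eqxx.
  move=> a r s; rewrite !unfold_in => /eqP-> /eqP->.
  by rewrite scaler0 addr0.
have ZE r : r \in Z -> r = 0 by move=> /eqP.
move/negP: ny0; apply; apply/eqP.
apply: (@regular_module_not_orthogonal R M Z subZ y0 ZE injE).
by apply/LX/d_isomorphic_zeroP => n x; apply: acyclic_tensor.
Qed.
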